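(* Let $n,m,p\ge1$ be integers, and let $N$, the action $\circ$ of $O(n)$ on $N$, the quotient manifold $N/O(n)$, the canonical projection $\pi:N\to N/O(n)$, the Riemannian metric $\langle\cdot,\cdot\rangle_\Theta$ on $N$, and horizontal lifts be as defined in the context. For $\xi,\zeta\in T_{[\Theta]}(N/O(n))$ define $$\langle\xi,\zeta\rangle_{[\Theta]}:=\langle\bar\xi_\Theta,\bar\zeta_\Theta\rangle_\Theta,$$ where $\bar\xi_\Theta,\bar\zeta_\Theta$ are the horizontal lifts of $\xi,\zeta$ at $\Theta\in\pi^{-1}([\Theta])$. Then this is well defined, i.e. $\langle\bar\xi_{\Theta_1},\bar\zeta_{\Theta_1}\rangle_{\Theta_1}=\langle\bar\xi_{\Theta_2},\bar\zeta_{\Theta_2}\rangle_{\Theta_2}$ for all $\Theta_1,\Theta_2\in\pi^{-1}([\Theta])$; it defines a Riemannian metric on $N/O(n)$, and with this metric $\pi:N\to N/O(n)$ is a Riemannian submersion.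
   Context: $\mathrm{Sym}_+(n)$ is the manifold of symmetric positive-definite real $n\times n$ matrices; $M=\mathrm{Sym}_+(n)\times\mathbf{R}^{n\times m}\times\mathbf{R}^{p\times n}$. A triple $(A,B,C)$ is controllable (resp. observable) if the discrete-time system $\hat x_{k+1}=A\hat x_k+B\hat u_k$, $\hat y_k=C\hat x_k$ is controllable (resp. observable). $N$ is the set of $\Theta=(A,B,C)\in M$ that are controllable and observable; it is open in $M$, so $T_\Theta N=T_\Theta M\cong\mathrm{Sym}(n)\times\mathbf{R}^{n\times m}\times\mathbf{R}^{p\times n}$, where $\mathrm{Sym}(n)$ is the space of symmetric real $n\times n$ matrices. The orthogonal group $O(n)$ acts on $N$ by $U\circ(A,B,C)=(U^{\top}AU,U^{\top}B,CU)$. $[\Theta]$ denotes the orbit of $\Theta$, $N/O(n)$ the set of orbits, and $\pi(\Theta)=[\Theta]$; $N/O(n)$ is given the smooth manifold structure for which $\pi$ is a smooth submersion. The Riemannian metric on $N$ is $$\langle(\xi_1,\eta_1,\zeta_1),(\xi_2,\eta_2,\zeta_2)\rangle_\Theta=\mathrm{tr}(A^{-1}\xi_1A^{-1}\xi_2)+\mathrm{tr}(\eta_1^\top\eta_2)+\mathrm{tr}(\zeta_1^\top\zeta_2),\qquad \Theta=(A,B,C).$$ The vertical space at $\Theta$ is $\mathcal{V}_\Theta=T_\Theta\pi^{-1}([\Theta])\subset T_\Theta N$, and the horizontal space $\mathcal{H}_\Theta$ is its orthogonal complement with respect to this metric. The horizontal lift $\bar\xi_\Theta$ of $\xi\in T_{[\Theta]}(N/O(n))$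 at $\Theta$ is the unique element of $\mathcal{H}_\Theta$ with $\mathrm{D}\pi(\Theta)[\bar\xi_\Theta]=\xi$. A Riemannian submersion is a smooth submersion whose differential at each $\Theta$ restricts to a linear isometry from $\mathcal{H}_\Theta$ onto the tangent space at $\pi(\Theta)$. *)

(* Defs.v *)
From HB Require Import structures.
From mathcomp Require Import all_boot all_order all_algebra.
From mathcomp Require Import all_classical all_reals all_analysis.

Set Implicit Arguments.
Unset Strict Implicit.
Unset Printing Implicit Defensive.

Import Order.TTheory GRing.Theory Num.Theory.
Import numFieldNormedType.Exports.

Local Open Scope classical_set_scope.
Local Open Scope ring_scope.

(* C^k and C^oo maps on an open set U, for finite-dimensional V and W: f is
   C^(k+1) when it is differentiable on U and all its directional derivatives
   are C^k on U. *)
Fixpoint Ck (R : realType) (V W : normedModType R) (k : nat) (U : set V)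
    (f : V -> W) : Prop :=
  match k with
  | 0 => {in U, continuous f}
  | k'.+1 => (forall x, U x -> differentiable f x) /\
             (forall v, Ck k' U (fun x => 'd f x v))
  end.

Definition smooth_on (R : realType) (V W : normedModType R) (U : set V)
    (f : V -> W) : Prop := forall k, Ck k U f.

(* The space tangent to F at x, for F an embedded submanifold of V: the
   velocities at x of the smooth curves drawn on F. *)
Definition velocities (R : realType) (V : normedModType R) (F : set V)
    (x : V) : set V :=
  [set v | exists (gamma : R^o -> V) (e : R), [/\ 0 < e,
     smooth_on [set t | - e < t < e] gamma,
     (forall t, - e < t < e -> F (gamma t)),
     gamma 0 = x & v = derive1 gamma 0]].

(* A manifold of dimension d is a set X of points of a type T with an atlas.
   Outside chart_dom (resp. outside the image of chart_dom) the values of a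
   chart (resp. of its inverse) are irrelevant. *)
Record chart (R : realType) (T : Type) (d : nat) := Chart {
  chart_dom : set T;
  chart_map :> T -> 'rV[R]_d;
  chart_inv : 'rV[R]_d -> T
}.

Section Manifold.
Variables (R : realType) (T : Type) (d : nat).
Implicit Types (X O : set T) (A : set (chart R T d)) (c : chart R T d).

Definition chart_img c : set 'rV[R]_d := c @` chart_dom c.

Definition is_chart X c : Prop :=
  [/\ chart_dom c `<=` X,
      {in chart_dom c, cancel c (chart_inv c)} &
      open (chart_img c)].

Definition compatible c1 c2 : Prop :=
  open (c1 @` (chart_dom c1 `&` chart_dom c2)) /\
  smooth_on (c1 @` (chart_dom c1 `&` chart_dom c2)) (c2 \o chart_inv c1).

(* The topology that makes every chart of the atlas a homeomorphism. *)
Definition atlas_open X A O : Prop :=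
  O `<=` X /\ forall c, A c -> open (c @` (O `&` chart_dom c)).

Record smooth_manifold X A : Prop := SmoothManifold {
  manifold_chart : forall c, A c -> is_chart X c;
  manifold_cover : forall x, X x -> exists2 c, A c & chart_dom c x;
  manifold_compatible : forall c1 c2, A c1 -> A c2 -> compatible c1 c2;
  manifold_hausdorff : forall x y, X x -> X y -> x <> y ->
    exists O1 O2, [/\ atlas_open X A O1, atlas_open X A O2, O1 x, O2 y &
                      O1 `&` O2 = set0];
  manifold_second_countable : exists B : nat -> set T,
    (forall i, atlas_open X A (B i)) /\
    (forall O x, atlas_open X A O -> O x -> exists2 i, B i x & B i `<=` O)
}.

Definition chart_at A (x : T) : set (chart R T d) :=
  [set c | A c /\ chart_dom c x].

(* A tangent vector at x is the family of its coordinates in the charts around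
   x, related by the differentials of the changes of charts. It is extended by
   0 to all the other charts, so that tangent vectors are functions, added and
   scaled pointwise, and equality of tangent vectors is Leibniz equality. *)
Definition tangent_vector : Type := chart R T d -> 'rV[R]_d.

HB.instance Definition _ := GRing.Lmodule.on tangent_vector.

Definition tangent_space A (x : T) : set tangent_vector :=
  [set v | (forall c, ~ chart_at A x c -> v c = 0) /\
     (forall c1 c2, chart_at A x c1 -> chart_at A x c2 ->
        v c2 = 'd (c2 \o chart_inv c1) (c1 x) (v c1))].

(* The tangent vector at x whose coordinates in the chart c are a. *)
Definition coord_vector A c (x : T) (a : 'rV[R]_d) : tangent_vector :=
  fun c' => if `[< chart_at A x c' >] then
              'd (c' \o chart_inv c) (c x) a
            else 0.

Record riemannian_metric X A
    (g : T -> tangent_vector -> tangent_vector -> R) : Prop :=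
  RiemannianMetric {
    metric_linear : forall x, X x -> forall (a : R) u v w,
      tangent_space A x u -> tangent_space A x v -> tangent_space A x w ->
      g x (a *: u + v) w = a * g x u w + g x v w;
    metric_sym : forall x, X x -> forall u v,
      tangent_space A x u -> tangent_space A x v -> g x u v = g x v u;
    metric_pos : forall x, X x -> forall u,
      tangent_space A x u -> u <> 0 -> 0 < g x u u;
    metric_smooth : forall c, A c -> forall a b : 'rV[R]_d,
      smooth_on (chart_img c)
        (fun y => g (chart_inv c y) (coord_vector A c (chart_inv c y) a)
                    (coord_vector A c (chart_inv c y) b) : R^o)
  }.

(* Maps f from an open subset U of a finite-dimensional normed space V to the
   manifold X; the tangent space to U at any of its points is V. *)
Section Maps.
Variables (V : normedModType R) (U : set V) (X : set T)
  (A : set (chart R T d)) (f : V -> T).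

Definition smooth_map : Prop :=
  (forall x, U x -> X (f x)) /\
  (forall c, A c -> open (U `&` f @^-1` chart_dom c) /\
                    smooth_on (U `&` f @^-1` chart_dom c) (c \o f)).

Definition mdiff (x v : V) : tangent_vector :=
  fun c => if `[< chart_at A (f x) c >] then 'd (c \o f) x v else 0.

Definition smooth_submersion : Prop :=
  smooth_map /\
  (forall x, U x -> set_surj [set: V] (tangent_space A (f x)) (mdiff x)).

Definition vertical (x : V) : set V :=
  velocities (U `&` f @^-1` [set f x]) x.

Variable gU : V -> V -> V -> R.

Definition horizontal (x : V) : set V :=
  [set h | forall v, vertical x v -> gU x h v = 0].

Definition horizontal_lift (x : V) (xi : tangent_vector) : V :=
  xget 0 [set h | horizontal x h /\ mdiff x h = xi].

Definition riemannian_submersion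
    (g : T -> tangent_vector -> tangent_vector -> R) : Prop :=
  smooth_submersion /\
  (forall x, U x ->
     [/\ set_bij (horizontal x) (tangent_space A (f x)) (mdiff x),
         (forall (a : R) h k, horizontal x h -> horizontal x k ->
            mdiff x (a *: h + k) = a *: mdiff x h + mdiff x k) &
         (forall h k, horizontal x h -> horizontal x k ->
            g (f x) (mdiff x h) (mdiff x k) = gU x h k)]).

End Maps.

End Manifold.

(* The normed space Sym(n) of symmetric matrices. *)
Section Sym.
Variables (R : realType) (n : nat).

Definition symmx : {pred 'M[R]_n} := fun S => S^T == S.

Lemma symmx_submod_closed : submod_closed symmx.
Proof.
split=> [|a S1 S2]; rewrite !unfold_in; first by rewrite trmx0.
by move=> /eqP e1 /eqP e2; rewrite linearP /= e1 e2.
Qed.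

HB.instance Definition _ :=
  GRing.isSubmodClosed.Build R 'M[R]_n symmx symmx_submod_closed.

Record sym := Sym { sym_val :> 'M[R]_n; _ : sym_val \in symmx }.

HB.instance Definition _ := [isSub for sym_val].
HB.instance Definition _ := [Choice of sym by <:].
HB.instance Definition _ := [SubChoice_isSubLmodule of sym by <:].

Definition sym_norm (S : sym) : R := `|sym_val S|.

Lemma sym_norm_triangle S1 S2 :
  sym_norm (S1 + S2) <= sym_norm S1 + sym_norm S2.
Proof. exact: ler_normD. Qed.

Lemma sym_normZ (a : R) S : sym_norm (a *: S) = `|a| * sym_norm S.
Proof. exact: normrZ. Qed.

Lemma sym_norm_eq0 S : sym_norm S = 0 -> S = 0.
Proof. by move/normr0_eq0 => h; apply: val_inj. Qed.

HB.instance Definition _ :=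
  @Lmodule_isNormed.Build R sym sym_norm sym_norm_triangle sym_normZ
    sym_norm_eq0.

Lemma conj_symmx (U : 'M[R]_n) (S : sym) : U^T *m S *m U \in symmx.
Proof.
case: S => S /=; rewrite !unfold_in => /eqP e.
by rewrite !trmx_mul trmxK e mulmxA.
Qed.

Definition sym_conj (U : 'M[R]_n) (S : sym) : sym := Sym (conj_symmx U S).

End Sym.

Definition posdefmx (R : realType) (n : nat) (S : 'M[R]_n) : Prop :=
  forall x : 'cV[R]_n, x != 0 -> 0 < (x^T *m S *m x) 0 0.

Section System.
Variables (R : realType) (n m p : nat).

Fixpoint state (A : 'M[R]_n) (B : 'M[R]_(n, m)) (u : nat -> 'cV[R]_m)
    (x0 : 'cV[R]_n) (k : nat) : 'cV[R]_n :=
  if k is k'.+1 then A *m state A B u x0 k' + B *m u k' else x0.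

(* Every state is driven to every state by some finite sequence of inputs. *)
Definition controllable (A : 'M[R]_n) (B : 'M[R]_(n, m)) : Prop :=
  forall x0 x1 : 'cV[R]_n, exists u K, state A B u x0 K = x1.

(* The inputs and the outputs determine the initial state. *)
Definition observable (A : 'M[R]_n) (B : 'M[R]_(n, m)) (C : 'M[R]_(p, n)) :
    Prop :=
  forall u (x0 x0' : 'cV[R]_n),
    (forall k, C *m state A B u x0 k = C *m state A B u x0' k) -> x0 = x0'.

(* Sym(n) x R^(n x m) x R^(p x n), the tangent space to N at every point. *)
Definition triple : normedModType R :=
  (sym R n * 'M[R]_(n, m) * 'M[R]_(p, n))%type.

Definition mxA (x : triple) : sym R n := x.1.1.
Definition mxB (x : triple) : 'M[R]_(n, m) := x.1.2.
Definition mxC (x : triple) : 'M[R]_(p, n) := x.2.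

Definition spaceM : set triple := [set x | posdefmx (mxA x)].

Definition spaceN : set triple :=
  [set x | [/\ spaceM x, controllable (mxA x) (mxB x) &
               observable (mxA x) (mxB x) (mxC x)]].

Definition orthogonal_group : set 'M[R]_n := [set U | U^T *m U = 1%:M].

Definition On_action (U : 'M[R]_n) (x : triple) : triple :=
  (sym_conj U (mxA x), U^T *m mxB x, mxC x *m U).

Definition On_orbit (x : triple) : set triple :=
  [set On_action U x | U in orthogonal_group].

(* N / O(n); the canonical projection is On_orbit. *)
Definition orbit_space : set (set triple) := On_orbit @` spaceN.

Definition metricN (x v w : triple) : R :=
  \tr (invmx (mxA x) *m mxA v *m invmx (mxA x) *m mxA w)
  + \tr ((mxB v)^T *m mxB w) + \tr ((mxC v)^T *m mxC w).

Variables (d : nat) (A : set (chart R (set triple) d)).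

Definition liftN (x : triple) (xi : tangent_vector R (set triple) d) : triple :=
  horizontal_lift spaceN A On_orbit metricN x xi.

(* The inner product on the tangent space at the orbit q, computed at a chosen
   representative of q. *)
Definition quotient_metric (q : set triple)
    (xi zeta : tangent_vector R (set triple) d) : R :=
  let x := xget 0 (spaceN `&` On_orbit @^-1` [set q]) in
  metricN x (liftN x xi) (liftN x zeta).

End System.

(* Main.v *)
Require Import Defs.
From HB Require Import structures.
From mathcomp Require Import all_boot all_order all_algebra.
From mathcomp Require Import all_classical all_reals all_analysis.
From mathcomp Require Import ring lra.
Import Order.TTheory GRing.Theory Num.Theory.
Import numFieldNormedType.Exports.
Local Open Scope classical_set_scope.
Local Open Scope ring_scope.
Set Implicit Arguments.
Unset Strict Implicit.
Unset Printing Implicit Defensive.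

(** Near an orbit, a chart [c] of the quotient turns the projection into a map
    F from an open set of the vector space of triples to R^d, smooth and with
    surjective differential.  The proof rests on two facts about F.

    The vertical space is the kernel of dF ([verticalE]).  The velocity of a
    curve drawn on an orbit is in the kernel because F is constant along the
    curve ([velocities_fibre_ker]).  Conversely, a vector k of the kernel is
    killed by the differential of every function that is constant on the orbit
    ([diff_fibre_ker]): by the Lyusternik-Graves theorem ([graves]) there are
    points of the orbit at distance o(t) from x + t k.  Controllability
    provides a map Psi, polynomial in (A, B), that recovers the matrix U^T from
    the point U o Theta of the orbit ([orbit_section]).  The identities that
    Psi satisfies along the orbit, once differentiated, say that k is the
    infinitesimal action of a skew-symmetric matrix ([mdiff_ker_skew]), and the
    Cayley transform of this matrix draws on the orbit a smooth curve of
    velocity k ([skew_vertical]).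

    A function g on R^d is smooth as soon as g o F is ([descent_smooth]).  Its
    differential at F x is that of g o F at x composed with a right inverse of
    dF which is smooth in x, so that the order of differentiability can be
    raised step by step, with no smooth local section of F.

    The rest is linear algebra.  The metric is positive definite
    ([metricN_pos]), so horizontal lifts exist and are unique.  O(n) acts by
    linear isometries that commute with the projection, and so it exchanges
    the lifts at the points of an orbit ([lift_equivariant]): the inner product
    of two lifts depends only on the orbit.  In a chart it is given by the
    matrix (D^T Q D)^-1, where D is the matrix of dF and Q that of the inverse
    of the metric ([gU_lift]).  This is a smooth function of Theta, hence of
    the coordinates of the orbit. *)

(** * Smooth maps between normed spaces *)

Section DiffEps.
Variables (R : realType) (V W : normedModType R).

Lemma diff_littleo (f : V -> W) x : differentiable f x ->
  forall e, 0 < e ->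
    \forall h \near 0, `|f (h + x) - f x - 'd f x h| <= e * `|h|.
Proof.
move=> /diff_locally /eqaddoP H e e0.
have := H e e0; apply: filterS => h /=.
by rewrite /= opprD addrA.
Qed.

Lemma littleo_diff (f : V -> W) x (L : {linear V -> W}) : continuous L ->
  (forall e, 0 < e ->
    \forall h \near 0, `|f (h + x) - f x - L h| <= e * `|h|) ->
  differentiable f x /\ 'd f x = L :> (V -> W).
Proof.
move=> Lc H.
have E : f \o shift x = cst (f x) + L +o_ 0 id.
  apply/eqaddoP => e e0; have := H e e0; apply: filterS => h /=.
  by rewrite /= opprD addrA.
have D := diff_unique Lc E.
by split=> //; apply/diff_locallyP; rewrite D.
Qed.

Lemma near_eq_diff (f g : V -> W) x : (\forall y \near x, f y = g y) ->
  differentiable f x -> differentiable g x /\ 'd g x = 'd f x :> (V -> W).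
Proof.
move=> fg df; apply: littleo_diff; first exact: diff_continuous.
move=> e e0; have fgx := nbhs_singleton fg.
have H := diff_littleo df e0.
have fg0 : \forall h \near (0 : V), f (h + x) = g (h + x).
  by move: fg; rewrite (near_shift 0 x) subr0.
near=> h.
by rewrite -(near fg0 h) // -fgx; near: h.
Unshelve. all: by end_near. Qed.

End DiffEps.

Section Smooth.
Variables (R : realType) (V : normedModType R) (U : set V).
Hypothesis openU : open U.

Lemma openU_near x : U x -> \forall y \near x, U y.
Proof. by move=> Ux; move: openU; rewrite openE => /(_ x Ux). Qed.

Section Codomain.
Variable W : normedModType R.
Implicit Types f g : V -> W.

(** The differential at a point only depends on the germ of the map, which is
    why [U] has to be open. *)
Lemma eq_Ck k f g : {in U, f =1 g} -> Ck k U f -> Ck k U g.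
Proof.
elim: k f g => [|k IH] f g fg /=.
  move=> cf x Ux; have fgx := fg x Ux.
  have near_fg : \forall y \near x, f y = g y.
    by apply: filterS (openU_near (set_mem Ux)) => y Uy; apply: fg; apply: mem_set.
  rewrite /continuous_at -fgx; apply: (cvg_trans _ (cf x Ux)).
  by apply: near_eq_cvg.
move=> [df dvf].
have E x : U x -> differentiable g x /\ 'd g x = 'd f x :> (V -> W).
  move=> Ux; apply: near_eq_diff (df x Ux).
  by apply: filterS (openU_near Ux) => y Uy; apply: fg; apply: mem_set.
split=> [x /E [] //|v]; apply: IH (dvf v) => x /set_mem Ux.
exact: esym (congr1 (@^~ v) (E x Ux).2).
Qed.

Lemma sub_Ck k f (U' : set V) : U' `<=` U -> Ck k U f -> Ck k U' f.
Proof.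
move=> sU; elim: k f => [|k IH] f /=.
  by move=> cf x /set_mem/sU Ux; apply: cf; apply: mem_set.
by move=> [df dvf]; split=> [x /sU /df //|v]; apply: IH.
Qed.

Lemma CkW k f : Ck k.+1 U f -> Ck k U f.
Proof.
elim: k f => [|k IH] f /= [df dvf].
  by move=> x /set_mem Ux; apply/differentiable_continuous/df.
by split=> // v; apply: IH; apply: dvf.
Qed.

Lemma Ck_cst k (a : W) : Ck k U (fun=> a).
Proof.
elim: k a => [|k IH] a /=; first by move=> x _; apply: cvg_cst.
split=> [x _|v]; first exact: (differentiable_cst a x).
have -> : (fun x => 'd (fun=> a) x v) = (fun=> 0).
  by apply/funext => x; rewrite (diff_cst a x).
exact: IH.
Qed.

Lemma CkD k f g : Ck k U f -> Ck k U g -> Ck k U (fun x => f x + g x).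
Proof.
elim: k f g => [|k IH] f g /=.
  by move=> cf cg x Ux; apply: cvgD; [apply: cf|apply: cg].
move=> [df dvf] [dg dvg]; split=> [x Ux|v].
  exact: (differentiableD (df x Ux) (dg x Ux)).
apply: eq_Ck (IH _ _ (dvf v) (dvg v)) => x /set_mem Ux.
exact: esym (congr1 (@^~ v) (diffD (df x Ux) (dg x Ux))).
Qed.

Lemma Ck_sum k (I : finType) (F : I -> V -> W) :
  (forall i, Ck k U (F i)) -> Ck k U (fun x => \sum_i F i x).
Proof.
move=> H; have E : (fun x => \sum_i F i x) = \sum_i F i.
  by apply/funext => x; rewrite fct_sumE.
rewrite E; elim/big_ind: _ => [|f g|i _]; first exact: Ck_cst.
  exact: CkD.
exact: H.
Qed.

Lemma Ck_linear k (L : {linear V -> W}) : continuous L -> Ck k U L.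
Proof.
move=> Lc; case: k => [|k] /=; first by move=> x _; apply: Lc.
split=> [x _|v]; first exact: linear_differentiable.
have -> : (fun x => 'd L x v) = (fun=> L v).
  by apply/funext => x; rewrite diff_lin.
exact: Ck_cst.
Qed.

End Codomain.

Lemma Ck_comp_linear k (W W' : normedModType R) (f : V -> W) (L : {linear W -> W'}) :
  continuous L -> Ck k U f -> Ck k U (fun x => L (f x)).
Proof.
move=> Lc; elim: k f => [|k IH] f /=.
  move=> cf x Ux; apply: continuous_comp; [exact: cf|exact: Lc].
move=> [df dvf]; split=> [x Ux|v].
  by apply: (@differentiable_comp _ _ _ _ f L); [apply: df|apply: linear_differentiable].
apply: (@eq_Ck _ k (fun x => L ('d f x v))); last exact: IH.
move=> x /set_mem Ux.
rewrite (@diff_comp _ _ _ _ f L) //=; last exact: linear_differentiable.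
  by rewrite diff_lin.
exact: df.
Qed.

Implicit Types f g : V -> R^o.

Lemma CkM k f g : Ck k U f -> Ck k U g -> Ck k U (fun x => f x * g x : R^o).
Proof.
elim: k f g => [|k IH] f g Cf Cg.
  by move=> x Ux; apply: cvgM; [apply: Cf|apply: Cg].
have [df dvf] := Cf; have [dg dvg] := Cg; split=> [x Ux|v].
  exact: (differentiableM (df x Ux) (dg x Ux)).
apply: (@eq_Ck _ k (fun x => f x * 'd g x v + g x * 'd f x v)).
  move=> x /set_mem Ux.
  exact: esym (congr1 (@^~ v) (diffM (df x Ux) (dg x Ux))).
apply: CkD; first exact: IH (CkW Cf) (dvg v).
exact: IH (CkW Cg) (dvf v).
Qed.

Lemma Ck_scale k (W : normedModType R) f (w : W) :
  Ck k U f -> Ck k U (fun x => f x *: w).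
Proof.
elim: k f => [|k IH] f.
  move=> Cf x Ux; apply: (@continuous_comp _ _ _ f ( *:%R^~ w) x (Cf x Ux)).
  exact: scalel_continuous.
move=> [df dvf]; split=> [x Ux|v]; first exact: (differentiableZl w (df x Ux)).
apply: eq_Ck (IH _ (dvf v)) => x /set_mem Ux.
exact: esym (congr1 (@^~ v) (diffZl w (df x Ux))).
Qed.

(** The derivative - f^-2 df of 1 / f involves 1 / f itself at one order less,
    hence the induction on the order for a fixed [f]. *)
Lemma CkV k f : (forall x, U x -> f x != 0) ->
  Ck k U f -> Ck k U (fun x => (f x)^-1 : R^o).
Proof.
move=> f0; elim: k => [|k IH] Cf.
  by move=> x Ux; apply: cvgV; [apply: f0; apply: set_mem|apply: Cf].
have [df dvf] := Cf; split=> [x Ux|v].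
  exact: (differentiableV (df x Ux) (f0 x Ux)).
have Cg := IH (CkW Cf).
have Cd : Ck k U (fun x => - 1 * ((f x)^-1 * (f x)^-1) * 'd f x v : R^o).
  exact: CkM (CkM (Ck_cst _ _) (CkM Cg Cg)) (dvf v).
apply: eq_Ck Cd => x /set_mem Ux.
rewrite -invfM -expr2 mulN1r.
exact: esym (congr1 (@^~ v) (diffV (df x Ux) (f0 x Ux))).
Qed.

Lemma Ck_prod k (I : finType) (F : I -> V -> R^o) :
  (forall i, Ck k U (F i)) -> Ck k U (fun x => \prod_i F i x : R^o).
Proof.
move=> H; rewrite /index_enum; elim: (Finite.enum I) => [|i s IH].
  by under eq_fun do rewrite big_nil; apply: Ck_cst.
by under eq_fun do rewrite big_cons /=; exact: CkM (H i) IH.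
Qed.

End Smooth.

(** * Smooth matrix-valued maps *)

Section MatrixCoordinate.
Variables (R : realType) (a b : nat) (i : 'I_a) (j : 'I_b).

Definition mx_coord (M : 'M[R]_(a, b)) : R^o := M i j.

Lemma mx_coord_is_linear : linear mx_coord.
Proof. by move=> c M N; rewrite /mx_coord !mxE. Qed.

HB.instance Definition _ :=
  GRing.isLinear.Build R 'M[R]_(a, b) R^o *:%R mx_coord mx_coord_is_linear.

Lemma mx_coord_continuous : continuous mx_coord.
Proof. exact: coord_continuous. Qed.

End MatrixCoordinate.

Section SmoothMatrix.
Variables (R : realType) (V : normedModType R) (U : set V).
Hypothesis openU : open U.

(** Smoothness entry by entry: it avoids differentiating matrix products and
    inverses as maps between normed spaces of matrices. *)
Definition CkMx k a b (M : V -> 'M[R]_(a, b)) : Prop :=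
  forall i j, Ck k U (fun x => M x i j : R^o).

Lemma Ck_entry k a b (M : V -> 'M[R]_(a, b)) : Ck k U M -> CkMx k M.
Proof.
by move=> CM i j; apply: (Ck_comp_linear openU (@mx_coord_continuous R a b i j)).
Qed.

Lemma eq_CkMx k a b (M N : V -> 'M[R]_(a, b)) :
  {in U, M =1 N} -> CkMx k M -> CkMx k N.
Proof. by move=> MN CM i j; apply: (eq_Ck openU) (CM i j) => x Ux; rewrite MN. Qed.

Lemma CkMx_cst k a b (A : 'M[R]_(a, b)) : CkMx k (fun=> A).
Proof. by move=> i j; apply: Ck_cst. Qed.

Lemma CkMxD k a b (M N : V -> 'M[R]_(a, b)) :
  CkMx k M -> CkMx k N -> CkMx k (fun x => M x + N x).
Proof.
by move=> CM CN i j; under eq_fun do rewrite mxE; exact: CkD (CM i j) (CN i j).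
Qed.

Lemma CkMxM k a b c (M : V -> 'M[R]_(a, b)) (N : V -> 'M[R]_(b, c)) :
  CkMx k M -> CkMx k N -> CkMx k (fun x => M x *m N x).
Proof.
move=> CM CN i j; under eq_fun do rewrite mxE.
by apply: (Ck_sum openU) => l; exact: CkM (CM i l) (CN l j).
Qed.

Lemma CkMx_scale k a b (s : V -> R^o) (M : V -> 'M[R]_(a, b)) :
  Ck k U s -> CkMx k M -> CkMx k (fun x => s x *: M x).
Proof.
by move=> Cs CM i j; under eq_fun do rewrite mxE; exact: CkM Cs (CM i j).
Qed.

Lemma CkMx_tr k a b (M : V -> 'M[R]_(a, b)) :
  CkMx k M -> CkMx k (fun x => (M x)^T).
Proof. by move=> CM i j; under eq_fun do rewrite mxE; exact: CM. Qed.

Lemma Ck_det k a (M : V -> 'M[R]_a) :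
  CkMx k M -> Ck k U (fun x => \det (M x) : R^o).
Proof.
move=> CM; apply: (Ck_sum openU) => s; apply: (CkM openU (Ck_cst _ _ _)).
by apply: (Ck_prod openU) => i; exact: CM.
Qed.

(** Cramer's rule: the entries of the inverse are quotients of polynomials in
    the entries, the denominator being the determinant. *)
Lemma CkMx_inv k a (M : V -> 'M[R]_a) : (forall x, U x -> M x \in unitmx) ->
  CkMx k M -> CkMx k (fun x => invmx (M x)).
Proof.
move=> uM CM.
have E : {in U, (fun x => (\det (M x))^-1 *: \adj (M x)) =1 (fun x => invmx (M x))}.
  by move=> x /set_mem /uM Ux; rewrite /invmx Ux.
apply: (eq_CkMx E); apply: CkMx_scale.
  by apply: (CkV openU) (Ck_det CM) => x /uM; rewrite unitmxE unitfE.
move=> i j; under eq_fun do rewrite mxE.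
apply: (CkM openU (Ck_cst _ _ _)); apply: Ck_det => u v.
by under eq_fun do rewrite !mxE; exact: CM.
Qed.

End SmoothMatrix.

(** * The mean value inequality *)

Lemma norm_entry (R : realType) (a b : nat) (M : 'M[R]_(a, b)) i j :
  `|M i j| <= `|M|.
Proof.
rewrite [leRHS]mx_normrE.
exact: (le_bigmax _ (fun k : 'I_a * 'I_b => `|M k.1 k.2|) (i, j)).
Qed.

Lemma norm_mx_le (R : realType) (a b : nat) (M : 'M[R]_(a, b)) (e : R) :
  0 <= e -> (forall i j, `|M i j| <= e) -> `|M| <= e.
Proof.
by move=> e0 H; rewrite [leLHS]mx_normrE; apply: bigmax_le => // -[i j] _.
Qed.

Lemma is_diff_derive (R : realType) (V W : normedModType R) (f df : V -> W) x v :
  is_diff x f df -> is_derive x v f (df v).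
Proof.
move=> [dfx dfE]; split; first exact: diff_derivable.
by rewrite deriveE // dfE.
Qed.

Section MeanValue.
Variables (R : realType) (V : normedModType R).

(** The mean value theorem on the segment from [y] to [x] for the map
    t |-> f (y + t (x - y)) - t T (x - y), whose derivative is ('d f - T) (x - y). *)
Lemma mean_value_scalar (f : V -> R^o) (x0 : V) (r e : R) (T : V -> R) :
  (forall z, `|z - x0| < r ->
     differentiable f z /\ forall v, `|'d f z v - T v| <= e * `|v|) ->
  forall x y, `|x - x0| < r -> `|y - x0| < r ->
    `|f x - f y - T (x - y)| <= e * `|x - y|.
Proof.
move=> df x y xr yr; set v := x - y.
pose l (t : R^o) : V := y + t *: v.
have dl (t : R^o) : is_diff t l ( *:%R^~ v).
  have h := is_diffD (is_diff_cst y t) (is_diff_scalel t v).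
  by apply: (is_diff_eq h); rewrite add0r.
have lr (t : R) : t \in `[0, 1]%R -> `|l t - x0| < r.
  rewrite in_itv /= => /andP[t0 t1].
  (* The ball is convex. *)
  have -> : l t - x0 = (1 - t) *: (y - x0) + t *: (x - x0).
    rewrite [(1 - t) *: _]scalerBl scale1r -[RHS]addrA [- (t *: _) + _]addrC.
    by rewrite -[t *: _ - _]scalerBr opprB addrA subrK addrAC.
  have t1' : 0 <= 1 - t by rewrite subr_ge0.
  apply: (le_lt_trans (ler_normD _ _)); rewrite !normrZ (ger0_norm t0) (ger0_norm t1').
  have := xr; have := yr; set p := `|y - x0|; set q := `|x - x0| => pr qr.
  have [pq|qp] := lerP p q; nra.
pose phi (t : R^o) : R^o := f (l t) - t * T v.
have dphi (t : R) : t \in `[0, 1]%R -> is_derive (t : R^o) 1 phi ('d f (l t) v - T v).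
  move=> t01; have [dft _] := df _ (lr t t01).
  have h1 : is_derive (t : R^o) 1 (f \o l) ('d f (l t) v).
    have h := is_diff_derive (1 : R^o) (is_diff_comp (dl t) (differentiableP dft)).
    by move: h; rewrite /= scale1r.
  have h2 : is_derive (t : R^o) 1 ( *:%R^~ (T v : R^o)) (T v).
    have h := is_diff_derive (1 : R^o) (is_diff_scalel (t : R^o) (T v : R^o)).
    by move: h; rewrite /= scale1r.
  exact: is_deriveB.
have dphio (t : R) : t \in `]0, 1[%R -> is_derive t 1 phi ('d f (l t) v - T v).
  by move=> t01; apply: dphi; apply: subset_itv_oo_cc t01.
have cphi : {within `[0, 1], continuous (phi : R -> R)}.
  by apply: derivable_within_continuous => t t01; case: (dphi t t01).
have [c c01] := MVT_segment ler01 dphio cphi.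
rewrite subr0 mulr1 /phi /l scale1r scale0r addr0 mul1r mul0r subr0.
rewrite [y + _]addrC subrK addrAC => ->.
exact: (df _ (lr c c01)).2.
Qed.
End MeanValue.

(** * Submersions *)

Lemma dotmx_eq0 (R : realType) (a : nat) (u : 'rV[R]_a) : u *m u^T = 0 -> u = 0.
Proof.
move=> /matrixP /(_ 0 0); rewrite !mxE => /eqP; rewrite psumr_eq0 => [/allP H|i _].
  apply/rowP => i; rewrite !mxE.
  by have := H i (mem_index_enum i); rewrite mxE -expr2 sqrf_eq0 => /eqP.
by rewrite mxE -expr2 sqr_ge0.
Qed.

Lemma row_inj_unitmx (F : fieldType) (a : nat) (M : 'M[F]_a) :
  (forall u : 'rV_a, u *m M = 0 -> u = 0) -> M \in unitmx.
Proof.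
move=> H; rewrite -row_free_unit -kermx_eq0; apply/rowV0P => u /sub_kermxP.
exact: H.
Qed.

(** The structure in which Banach's fixed point theorem is applied to row
    vectors. *)
HB.instance Definition _ (R : realType) a b := Complete.on 'M[R]_(a, b).

(** The norm of ['rV_d] is the supremum norm, so that it is enough to apply the
    scalar inequality to each coordinate. *)
Lemma mean_value_rV (R : realType) (V : normedModType R) (d : nat)
    (F : V -> 'rV[R]_d) (x0 : V) (r e : R) (T : V -> 'rV[R]_d) :
  0 <= e ->
  (forall z, `|z - x0| < r ->
     differentiable F z /\ forall v, `|'d F z v - T v| <= e * `|v|) ->
  forall x y, `|x - x0| < r -> `|y - x0| < r ->
    `|F x - F y - T (x - y)| <= e * `|x - y|.
Proof.
move=> e0 dF x y xr yr; apply: norm_mx_le; first by rewrite mulr_ge0.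
move=> i j; rewrite !mxE.
apply: (@mean_value_scalar R V (mx_coord i j \o F) x0 r e (fun v => T v i j)) => //.
move=> z /dF [dFz dFzv].
have dc : differentiable (@mx_coord R 1 d i j) (F z).
  by apply: linear_differentiable; apply: mx_coord_continuous.
split=> [|v]; first exact: differentiable_comp.
rewrite (diff_comp dFz dc) /= diff_lin; last exact: mx_coord_continuous.
apply: le_trans (dFzv v); rewrite /mx_coord.
by have := norm_entry ('d F z v - T v) i j; rewrite !mxE.
Qed.

Lemma lipschitz_linear_continuous (R : realType) (V W : normedModType R)
    (L : {linear V -> W}) (k : R) : (forall z, `|L z| <= k * `|z|) -> continuous L.
Proof.
move=> Lk; apply/linear_bounded_continuous/linear_boundedP.
apply: filterS (nbhs_pinfty_ge (num_real k)) => r kr x.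
by apply: (le_trans (Lk x)); rewrite ler_wpM2r.
Qed.

(** A frame of [V]: a linear coordinate map [co] to some ['rV_N] and a linear
    map [E] back with E (co v) = v.  The vectors E (e_i) generate [V] without
    being independent in general; for symmetric matrices this leaves one
    coordinate for each entry. *)
Section Submersion.
Variables (R : realType) (V : normedModType R) (N : nat).
Variables (co : {linear V -> 'rV[R]_N}) (E : {linear 'rV[R]_N -> V}).
Hypotheses (coK : cancel co E) (co_cont : continuous co).

Lemma frame_sum v : v = \sum_i co v 0 i *: E (delta_mx 0 i).
Proof.
rewrite -[LHS]coK {1}[co v]row_sum_delta linear_sum.
by apply: eq_bigr => i _; rewrite linearZZ.
Qed.

Section Local.
Variables (d : nat) (O : set V) (F : V -> 'rV[R]_d).
Hypotheses (openO : open O) (F1 : Ck 1 O F).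

(** The definition of C^1 maps only says that each directional derivative is
    continuous.  As finitely many directions generate [V], the differential is
    continuous in operator norm. *)
Lemma Ck1_diff_near x0 e : O x0 -> 0 < e ->
  exists2 r, 0 < r & forall z, `|z - x0| < r ->
    O z /\ forall v, `|'d F z v - 'd F x0 v| <= e * `|v|.
Proof.
move=> Ox0 e0; have [c c0 coc] := linear_lipschitz co_cont.
pose e' := e / (N.+1%:R * c).
have e'0 : 0 < e' by rewrite divr_gt0 // mulr_gt0.
have /= [_ dF] := F1.
have : \forall z \near x0,
    O z /\ forall i, `|'d F z (E (delta_mx 0 i)) - 'd F x0 (E (delta_mx 0 i))| < e'.
  apply: filterI; first exact: openU_near.
  apply: filter_forall => i.
  have /cvgrPdist_lt /(_ e' e'0) := dF (E (delta_mx 0 i)) x0 (mem_set Ox0).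
  by apply: filterS => z; rewrite distrC.
move=> /nbhs_normP [r r0 H]; exists r => // z zr.
have [Oz Hz] : O z /\ forall i,
    `|'d F z (E (delta_mx 0 i)) - 'd F x0 (E (delta_mx 0 i))| < e'.
  by apply: H; rewrite /= distrC.
split=> // v; have dE u : 'd F u v = \sum_i 'd F u (co v 0 i *: E (delta_mx 0 i)).
  by rewrite -linear_sum -frame_sum.
rewrite !dE -sumrB.
apply: (le_trans (ler_norm_sum _ _ _)).
have le1 : forall i : 'I_N, true -> `|'d F z (co v 0 i *: E (delta_mx 0 i)) -
    'd F x0 (co v 0 i *: E (delta_mx 0 i))| <= c * `|v| * e'.
  move=> i _; rewrite ['d F z _]linearZZ ['d F x0 _]linearZZ -scalerBr normrZ.
  apply: ler_pM => //; last exact/ltW.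
  exact: le_trans (norm_entry _ _ _) (coc v).
apply: (le_trans (ler_sum _ le1)); rewrite sumr_const card_ord -mulr_natr.
have -> : c * `|v| * e' * N%:R = e * `|v| * (N%:R / N.+1%:R).
  have : N.+1%:R != 0 :> R by rewrite pnatr_eq0.
  rewrite /e'; move: (N.+1%:R : R) => M M0; field.
  by rewrite M0 gt_eqF.
rewrite ler_piMr ?mulr_ge0 //; first exact: ltW.
by rewrite ler_pdivrMr // mul1r ler_nat.
Qed.

(** The Lyusternik-Graves theorem: a C^1 map with surjective differential at [x0]
    is metrically regular around [x0].  With L a right inverse of 'd F x0, a
    solution of F (x + L z) = y is a fixed point of z |-> z - (F (x + L z) - y),
    a contraction of ratio 1/2 of the ball of radius 2 |y - F x| because F is
    approximated by 'd F x0 at the scale e = 1 / (2 c). *)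
Lemma graves x0 : O x0 -> set_surj [set: V] [set: 'rV[R]_d] ('d F x0) ->
  exists c r : R, [/\ 0 < c, 0 < r & forall x y, `|x - x0| < r ->
    `|y - F x| < r -> exists x', [/\ O x', F x' = y & `|x' - x| <= c * `|y - F x|]].
Proof.
move=> Ox0 surj.
have /choice [w dFw] : forall j : 'I_d, exists v, 'd F x0 v = delta_mx 0 j.
  by move=> j; have [v _ dv] := surj (delta_mx 0 j) I; exists v.
pose L (z : 'rV[R]_d) := \sum_j z 0 j *: w j.
have LB z z' : L z - L z' = L (z - z').
  by rewrite /L -sumrB; apply: eq_bigr => j _; rewrite !mxE scalerBl.
have dFL z : 'd F x0 (L z) = z.
  rewrite /L linear_sum [RHS]row_sum_delta; apply: eq_bigr => j _.
  by rewrite linearZZ dFw.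
pose c := 1 + \sum_j `|w j|.
have c0 : 0 < c by rewrite ltr_pwDl // sumr_ge0.
have Lc z : `|L z| <= c * `|z|.
  apply: (le_trans (ler_norm_sum _ _ _)); rewrite mulrDl mul1r mulr_suml.
  rewrite -[leLHS]add0r lerD //; apply: ler_sum => j _.
  by rewrite normrZ mulrC ler_wpM2l // norm_entry.
(* c bounds the norm of L, so that the contraction ratio is e * c = 1/2. *)
pose e := (2 * c)^-1.
have e0 : 0 < e by rewrite invr_gt0 mulr_gt0.
have [r0 r00 Hr] := Ck1_diff_near Ox0 e0.
exists (2 * c), (Num.min (r0 / 2) (r0 / (4 * c + 4 * c))).
split=> [||x y]; first by rewrite mulr_gt0.
  by rewrite lt_min !divr_gt0 // addr_gt0 // mulr_gt0.
rewrite !lt_min => /andP[xr _] /andP[_ yr].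
set s := `|y - F x| in yr *.
have s0 : 0 <= s by exact: normr_ge0.
pose Z : set 'rV[R]_d := [set z | `|z| <= 2 * s].
have Lr z : Z z -> `|x + L z - x0| < r0.
  rewrite /Z /= => zs; rewrite addrAC.
  apply: (le_lt_trans (ler_normD _ _)).
  have := Lc z; have cz : c * `|z| <= c * (2 * s) by rewrite ler_pM2l.
  move: yr xr; rewrite ltr_pdivlMr ?addr_gt0 ?mulr_gt0 // ltr_pdivlMr //.
  move: cz; nra.
pose Phi z := z - (F (x + L z) - y).
have addKB (a b : V) : x + a - (x + b) = a - b by rewrite opprD addrACA subrr add0r.
have lip z z' : Z z -> Z z' -> `|Phi z - Phi z'| <= 2^-1 * `|z - z'|.
  move=> Zz Zz'.
  have -> : Phi z - Phi z' =
      - (F (x + L z) - F (x + L z') - 'd F x0 (x + L z - (x + L z'))).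
    rewrite addKB LB dFL /Phi.
    by apply/rowP => j; rewrite !mxE; ring.
  rewrite normrN; apply: (le_trans (mean_value_rV (ltW e0) _ (Lr z Zz) (Lr z' Zz'))).
    by move=> u /Hr [Ou Hu]; split=> //; case: F1 => dF _; apply: dF.
  rewrite addKB LB.
  have -> : 2^-1 * `|z - z'| = e * (c * `|z - z'|).
    by rewrite /e; field; rewrite gt_eqF.
  by rewrite ler_pM2l.
have Z0 : Z 0 by rewrite /Z /= normr0 mulr_ge0.
have L0 : L 0 = 0 by rewrite -(subrr (0 : 'rV[R]_d)) -LB subrr.
have Phi_fun : set_fun Z Z Phi.
  move=> z Zz; rewrite /Z /=.
  have := lip z 0 Zz Z0; rewrite subr0 => H.
  have P0 : `|Phi 0| = s by rewrite /Phi L0 addr0 sub0r opprB.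
  have := ler_normD (Phi z - Phi 0) (Phi 0); rewrite subrK P0.
  move: Zz; rewrite /Z /=; lra.
pose PhiF : {fun Z >-> Z} := HB.pack Phi (isFun.Build _ _ _ _ Phi Phi_fun).
have half0 : 0 <= (2^-1 : R) by [].
have ctr : is_contraction PhiF.
  exists (NngNum half0); split=> /=; first lra.
  by move=> [z z'] [/= Zz Zz']; apply: lip.
have [|z Zz zE] := banach_fixed_point ctr _ (ex_intro _ 0 Z0).
  have -> : Z = Num.norm @^-1` [set t : R | t <= 2 * s] by [].
  apply: preimage_closed; last exact: closed_le.
  by move=> z _; apply: norm_continuous.
exists (x + L z); have [Oz _] := Hr _ (Lr z Zz).
split=> //.
  move: zE; rewrite /= /Phi => /eqP; rewrite eq_sym subr_eq -subr_eq0.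
  by rewrite opprD addrA subrr sub0r oppr_eq0 subr_eq0 => /eqP.
rewrite addrAC subrr add0r; apply: (le_trans (Lc z)).
by move: Zz; rewrite /Z /=; nra.
Qed.

(** A vector v of the kernel is tangent to the fibre in the weak sense that the
    fibre has points x' with x' = x0 + t v + o(t): as F (x0 + t v) = F x0 + o(t),
    metric regularity moves x0 + t v to the fibre by o(t).  Hence 'd h x0 v is the
    limit of (h x' - h x0) / t = 0.  The proof bounds its norm by a multiple of
    every small [eta]. *)
Lemma diff_fibre_ker (W : normedModType R) (h : V -> W) x0 : O x0 ->
  set_surj [set: V] [set: 'rV[R]_d] ('d F x0) -> differentiable h x0 ->
  (forall x, O x -> F x = F x0 -> h x = h x0) ->
  forall v, 'd F x0 v = 0 -> 'd h x0 v = 0.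
Proof.
move=> Ox0 surj dh hfib v dFv.
have dF : differentiable F x0 by case: F1 => dF _; apply: dF.
have [c [r [c0 r0 Hg]]] := graves Ox0 surj.
have [k k0 dhk] := linear_lipschitz (diff_continuous dh).
pose M := `|v| * (1 + c + k * c).
have bound eta : 0 < eta -> eta <= 1 -> `|'d h x0 v| <= eta * M.
  move=> eta0 eta1.
  have /nbhs_normP [r1 r10 H1] := diff_littleo dF eta0.
  have /nbhs_normP [r2 r20 H2] := diff_littleo dh eta0.
  pose q := (`|v| + 1) * (1 + c).
  have q0 : 0 < q by rewrite mulr_gt0 // ltr_wpDl // addr_ge0 // ltW.
  pose rho := Num.min r (Num.min r1 r2).
  have rho0 : 0 < rho by rewrite !lt_min r0 r10 r20.
  pose t := rho / (q + q).
  have t0 : 0 < t by rewrite divr_gt0 // addr_gt0.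
  have t0' := ltW t0; have c0' := ltW c0; have eta0' := ltW eta0.
  have tq : t * q < rho.
    have -> : t * q = rho / 2 by rewrite /t; field; rewrite gt_eqF // addr_gt0.
    by rewrite ltr_pdivrMr // ltr_pMr // ltr1n.
  have v0 : 0 <= `|v| by [].
  have ltv : `|t *: v| = t * `|v| by rewrite normrZ gtr0_norm.
  have tvq : t * `|v| * (1 + c) <= t * q.
    by rewrite /q mulrA ler_pM2r ?addr_gt0 // ler_pM2l // lerDl.
  have [rr [r1r r2r]] : rho <= r /\ rho <= r1 /\ rho <= r2.
    by split; [|split]; rewrite /rho !ge_min lexx ?orbT.
  have tv_small : t * `|v| < rho.
    apply: le_lt_trans tq; apply: le_trans tvq.
    by rewrite mulrDr mulr1 lerDl mulr_ge0 // mulr_ge0.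
  (* The point t v + x0 is almost on the fibre; x' is on it and close. *)
  have F_small : `|F x0 - F (t *: v + x0)| <= eta * (t * `|v|).
    have := H1 (t *: v); rewrite /= sub0r normrN ltv => /(_ (lt_le_trans tv_small r1r)).
    by rewrite linearZZ dFv scaler0 subr0 distrC.
  have [||x' [Ox' Fx' x'_near]] := Hg (t *: v + x0) (F x0).
  - by rewrite addrK ltv; apply: lt_le_trans tv_small rr.
  - apply: (le_lt_trans F_small); apply: le_lt_trans (lt_le_trans tv_small rr).
    by rewrite ler_piMl // mulr_ge0.
  set w := x' - (t *: v + x0) in x'_near.
  have w_small : `|w| <= c * (eta * (t * `|v|)).
    by apply: (le_trans x'_near); rewrite ler_pM2l.
  have x'E : x' = (w + t *: v) + x0 by rewrite /w -addrA subrK.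
  have u_small : `|w + t *: v| <= t * `|v| * (1 + c).
    apply: (le_trans (ler_normD _ _)); rewrite ltv mulrDr mulr1 addrC lerD2l.
    by apply: (le_trans w_small); rewrite mulrC ler_pM2r // ler_piMl // mulr_ge0.
  have := H2 (w + t *: v).
  have u_rho := le_lt_trans u_small (le_lt_trans tvq tq).
  rewrite /= sub0r normrN => /(_ (lt_le_trans u_rho r2r)).
  rewrite -x'E hfib // subrr sub0r normrN => dhu.
  have : `|'d h x0 (t *: v)| <= `|'d h x0 (w + t *: v)| + `|'d h x0 w|.
    have -> : 'd h x0 (t *: v) = 'd h x0 (w + t *: v) - 'd h x0 w.
      by rewrite linearD addrAC subrr add0r.
    exact: ler_normB.
  rewrite linearZZ normrZ gtr0_norm // => tdh.
  rewrite -(ler_pM2l t0); apply: (le_trans tdh).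
  have -> : t * (eta * M) =
      eta * (t * `|v| * (1 + c)) + k * (c * (eta * (t * `|v|))).
    by rewrite /M; ring.
  apply: lerD.
    by apply: (le_trans dhu); rewrite ler_pM2l.
  by apply: (le_trans (dhk w)); rewrite ler_pM2l.
have M0 : 0 <= M by rewrite mulr_ge0 // !addr_ge0 // ?mulr_ge0 // ltW.
apply/normr0_eq0/eqP; rewrite eq_le normr_ge0 andbT; apply/ler_addgt0Pr => e e0.
rewrite add0r.
have [e1 e1M] : 0 < Num.min 1 (e / (M + 1)) /\ Num.min 1 (e / (M + 1)) * M <= e.
  have M1 : 0 < M + 1 by rewrite ltr_wpDl.
  have : Num.min 1 (e / (M + 1)) <= e / (M + 1) by rewrite ge_min lexx orbT.
  have e'0 : 0 < Num.min 1 (e / (M + 1)) by rewrite lt_min ltr01 divr_gt0.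
  move: e'0; set m := Num.min _ _ => m0; rewrite ler_pdivlMr // => H; split => //.
  by apply: le_trans H; rewrite ler_pM2l // lerDl.
by apply: le_trans (bound _ e1 _) e1M; rewrite ge_min lexx.
Qed.

Section Descent.
Variable (g : 'rV[R]_d -> R^o).

(** The candidate for the differential is y |-> 'd (g o F) x0 (L y), for a right
    inverse L of 'd F x0; it satisfies l o 'd F x0 = 'd (g o F) x0 because
    'd (g o F) x0 vanishes on the kernel of 'd F x0.  Metric regularity writes
    any y near F x0 as F x' with |x' - x0| <= c |y - F x0|, which turns the
    expansions of F and g o F at x0 into one of g at F x0. *)
Lemma descent_differentiable x0 : O x0 ->
  set_surj [set: V] [set: 'rV[R]_d] ('d F x0) -> differentiable (g \o F) x0 ->
  differentiable g (F x0).
Proof.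
move=> Ox0 surj dh.
have dF : differentiable F x0 by case: F1 => dF _; apply: dF.
have [c [r [c0 r0 Hg]]] := graves Ox0 surj.
have /choice [w dFw] : forall j : 'I_d, exists v, 'd F x0 v = delta_mx 0 j.
  by move=> j; have [v _ dv] := surj (delta_mx 0 j) I; exists v.
pose l (z : 'rV[R]_d) : R^o := \sum_j z 0 j *: 'd (g \o F) x0 (w j).
have l_lin : linear l.
  move=> a y z; rewrite /l scaler_sumr -big_split; apply: eq_bigr => j _.
  by rewrite !mxE scalerDl scalerA.
pose lL : {linear 'rV[R]_d -> R^o} := HB.pack l (GRing.isLinear.Build _ _ _ _ _ l_lin).
have lE v : l ('d F x0 v) = 'd (g \o F) x0 v.
  have ker : 'd F x0 (v - \sum_j 'd F x0 v 0 j *: w j) = 0.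
    rewrite linearB linear_sum [X in X - _]row_sum_delta; apply/eqP.
    rewrite subr_eq0; apply/eqP/eq_bigr => j _.
    by rewrite linearZZ dFw.
  have fib x : O x -> F x = F x0 -> (g \o F) x = (g \o F) x0 by move=> _ /= ->.
  have := diff_fibre_ker Ox0 surj dh fib ker.
  rewrite linearB linear_sum => /subr0_eq ->.
  by rewrite /l; apply: eq_bigr => j _; rewrite linearZZ.
(* The linear map l is continuous, with bound k. *)
have lk : exists2 k, 0 < k & forall z, `|l z| <= k * `|z|.
  exists (1 + \sum_j `|'d (g \o F) x0 (w j)|) => [|z].
    by rewrite ltr_pwDl // sumr_ge0.
  apply: (le_trans (ler_norm_sum _ _ _)); rewrite mulrDl mul1r mulr_suml.
  rewrite -[leLHS]add0r lerD //; apply: ler_sum => j _.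
  by rewrite normrZ mulrC ler_wpM2l // norm_entry.
have [k k0 lk'] := lk.
have lc : continuous lL by exact: (@lipschitz_linear_continuous R _ _ lL k lk').
apply: (littleo_diff lc _).1 => e e0.
pose eta := e / (c * (1 + k)).
have eta0 : 0 < eta by rewrite divr_gt0 // mulr_gt0 // addr_gt0.
have /nbhs_normP [r1 r10 H1] := diff_littleo dF eta0.
have /nbhs_normP [r2 r20 H2] := diff_littleo dh eta0.
pose rho := Num.min r (Num.min (r1 / c) (r2 / c)).
have rho0 : 0 < rho by rewrite !lt_min r0 !divr_gt0.
apply/nbhs_normP; exists rho => // y; rewrite /= sub0r normrN !lt_min.
rewrite !ltr_pdivlMr // => /and3P[yr yr1 yr2].
have [||x' [Ox' Fx' x'_near]] := Hg x0 (y + F x0).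
- by rewrite subrr normr0.
- by rewrite addrK.
rewrite addrK in x'_near; set u := x' - x0 in x'_near.
have x'E : x' = u + x0 by rewrite subrK.
have ur s : c * `|y| < s -> ball_ Num.norm 0 s u.
  by rewrite /= sub0r normrN; apply: le_lt_trans.
have {H1} := H1 u (ur _ _); rewrite mulrC => /(_ yr1) /=.
rewrite -x'E Fx' addrK => H1u.
have {H2} := H2 u (ur _ _); rewrite mulrC => /(_ yr2) /=.
rewrite -x'E Fx' => H2u.
have -> : g (y + F x0) - g (F x0) - l y =
  (g (y + F x0) - g (F x0) - 'd (g \o F) x0 u) - l (y - 'd F x0 u).
  have -> : l (y - 'd F x0 u) = l y - l ('d F x0 u) by exact: (linearB lL).
  by rewrite lE opprB addrA subrK.
apply: (le_trans (ler_normB _ _)).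
have -> : e * `|y| = eta * (c * `|y|) + k * (eta * (c * `|y|)).
  by rewrite /eta; field; rewrite !gt_eqF // addr_gt0.
have ux : eta * `|u| <= eta * (c * `|y|) by rewrite ler_pM2l.
apply: lerD; first exact: le_trans H2u ux.
by apply: (le_trans (lk' _)); rewrite ler_pM2l //; apply: le_trans H1u ux.
Qed.
End Descent.
End Local.

Section Jacobian.
Variables (d : nat) (O : set V) (F : V -> 'rV[R]_d).
Hypotheses (openO : open O) (smoothF : smooth_on O F).
Hypothesis surjF : forall x, O x -> set_surj [set: V] [set: 'rV[R]_d] ('d F x).

Definition frame_jacobian x : 'M[R]_(N, d) :=
  \matrix_(i, j) 'd F x (E (delta_mx 0 i)) 0 j.
Local Notation D := frame_jacobian.

Lemma diff_frameE x r : 'd F x (E r) = r *m D x.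
Proof.
rewrite [r in LHS]row_sum_delta !linear_sum; apply/rowP => j; rewrite summxE mxE.
by apply: eq_bigr => i _; rewrite linearZZ linearZZ !mxE.
Qed.

Lemma diff_coE x v : 'd F x v = co v *m D x.
Proof. by rewrite -diff_frameE coK. Qed.

Lemma frame_jacobian_smooth k : CkMx O k D.
Proof.
move=> i j; under eq_fun do rewrite mxE.
have := (smoothF k.+1).2 (E (delta_mx 0 i)) => /(Ck_entry openO); exact.
Qed.

Lemma frame_jacobian_tr_inj x (u : 'rV_d) : O x -> u *m (D x)^T = 0 -> u = 0.
Proof.
move=> Ox uD; have surj := surjF Ox; have [v _ dv] := surj u I.
apply: dotmx_eq0; rewrite -{2}dv diff_coE trmx_mul mulmxA uD.
exact: mul0mx.
Qed.

(** Row vectors act on the left, so that (D^T D)^-1 D^T is a right inverse of the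
    differential; its entries are smooth in the base point. *)
Lemma gram_unitmx x : O x -> (D x)^T *m D x \in unitmx.
Proof.
move=> Ox; apply: row_inj_unitmx => u uDD.
apply: (frame_jacobian_tr_inj Ox); apply: dotmx_eq0.
by rewrite trmx_mul trmxK -mulmxA (mulmxA _ (D x)) mulmxA uDD mul0mx.
Qed.

(** By the chain rule, 'd g (F x) v = 'd (g o F) x (L_x v) with L_x a right inverse
    of 'd F x.  As L_x is smooth in x, the composite of F with y |-> 'd g y v is
    again smooth, and the induction hypothesis on the order applies to it. *)
Lemma descent_smooth (g : 'rV[R]_d -> R^o) :
  smooth_on O (g \o F) -> smooth_on (F @` O) g.
Proof.
move=> + k; elim: k g => [|k IH] g sg.
  move=> y /set_mem [x Ox <-]; apply: differentiable_continuous.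
  by apply: (descent_differentiable openO (smoothF 1) Ox (surjF Ox)); apply: (sg 1).1.
have dg x : O x -> differentiable g (F x).
  move=> Ox; apply: (descent_differentiable openO (smoothF 1) Ox (surjF Ox)).
  exact: (sg 1).1.
split=> [y [x Ox <-]|v]; first exact: dg.
apply: IH => l.
pose r x := v *m invmx ((D x)^T *m D x) *m (D x)^T.
have sr : CkMx O l r.
  have sD := frame_jacobian_smooth l.
  apply: CkMxM => //; last exact: CkMx_tr.
  apply: CkMxM => //; first exact: CkMx_cst.
  apply: CkMx_inv => //; first exact: gram_unitmx.
  by apply: CkMxM => //; apply: CkMx_tr.
have H : Ck l O (fun x => \sum_i r x 0 i * 'd (g \o F) x (E (delta_mx 0 i)) : R^o).
  apply: Ck_sum => // i; apply: CkM => //.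
  exact: (sg l.+1).2.
apply: (eq_Ck openO) H => x /set_mem Ox.
have dF : differentiable F x := (smoothF 1).1 x Ox.
transitivity ('d (g \o F) x (E (r x))).
  rewrite [r x in RHS]row_sum_delta !linear_sum.
  by apply: eq_bigr => i _; rewrite !linearZZ.
rewrite (diff_comp dF (dg x Ox)) /= diff_frameE.
have -> : r x *m D x = v *m invmx ((D x)^T *m D x) *m ((D x)^T *m D x).
  by rewrite [RHS]mulmxA.
by rewrite mulmxKV // gram_unitmx.
Qed.

End Jacobian.
End Submersion.

(** * Charts and tangent vectors *)

Lemma tangent_vectorE (R : realType) (T : Type) (d : nat) (a : R)
    (u v : tangent_vector R T d) c : (a *: u + v) c = a *: u c + v c.
Proof. by []. Qed.

Section ManifoldCharts.
Variables (R : realType) (T : Type) (d : nat) (X : set T) (A : set (chart R T d)).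
Hypothesis manifoldX : smooth_manifold X A.
Implicit Types (c : chart R T d) (q : T).

Lemma chart_invK c q : A c -> chart_dom c q -> chart_inv c (c q) = q.
Proof.
by move=> Ac cq; have [_ cK _] := manifold_chart manifoldX Ac; apply: cK; apply: mem_set.
Qed.

Lemma transition_differentiable q c1 c2 :
  chart_at A q c1 -> chart_at A q c2 -> differentiable (c2 \o chart_inv c1) (c1 q).
Proof.
move=> [A1 q1] [A2 q2]; have [_ /(_ 1) [H _]] := manifold_compatible manifoldX A1 A2.
by apply: H; exists q.
Qed.

(** The chain rule for a change of charts, for a map [p] which is either the
    projection of a submersion or the inverse of a chart.  The image point is
    named [q] so that the lemma applies when p x is only provably equal to it. *)
Lemma transition_comp (V : normedModType R) (O : set V) (p : V -> T) x q c1 c2 :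
  open O -> O x -> (forall y, O y -> chart_dom c1 (p y)) -> p x = q ->
  chart_at A q c1 -> chart_at A q c2 -> differentiable (c1 \o p) x ->
  forall v, 'd (c2 \o p) x v =
            'd (c2 \o chart_inv c1) (c1 q) ('d (c1 \o p) x v).
Proof.
move=> + + + pxq; case: q / pxq => openO Ox Op ch1 ch2 d1 v.
have d2 := transition_differentiable ch1 ch2.
have near_x : \forall y \near x, ((c2 \o chart_inv c1) \o (c1 \o p)) y = (c2 \o p) y.
  apply: filterS (openU_near openO Ox) => y Oy /=.
  by rewrite chart_invK //; [case: ch1|apply: Op].
have d12 := @differentiable_comp _ _ _ _ (c1 \o p) (c2 \o chart_inv c1) x d1 d2.
have D := (near_eq_diff near_x d12).2.
have D12 := @diff_comp _ _ _ _ (c1 \o p) (c2 \o chart_inv c1) x d1 d2.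
exact: (congr1 (fun h : V -> 'rV[R]_d => h v) (etrans D D12)).
Qed.

Lemma chart_inv_coord c q : chart_at A q c ->
  forall a, 'd (c \o chart_inv c) (c q) a = a.
Proof.
move=> [Ac cq] a; have [_ _ openc] := manifold_chart manifoldX Ac.
have Iq : chart_img c (c q) by exists q.
have near_q : \forall y \near c q, id y = (c \o chart_inv c) y.
  by apply: filterS (openU_near openc Iq) => _ [z cz <-] /=; rewrite chart_invK.
have idc : continuous (@idfun 'rV[R]_d) by move=> y.
have [_ ->] := near_eq_diff near_q (linear_differentiable (c q) idc).
by rewrite (diff_lin (c q) idc).
Qed.

Lemma coord_vector_chart c q a : chart_at A q c -> coord_vector A c q a c = a.
Proof.
by move=> ch; rewrite /coord_vector; case: asboolP => // _; exact: chart_inv_coord.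
Qed.

(** The cocycle relation of the changes of charts. *)
Lemma coord_vector_tangent c q a : chart_at A q c ->
  tangent_space A q (coord_vector A c q a).
Proof.
move=> ch; split=> [c' nch|c1 c2 ch1 ch2]; first by rewrite /coord_vector; case: asboolP.
rewrite /coord_vector; case: asboolP => // _; case: asboolP => // _.
have [Ac cq] := ch; have [A1 q1] := ch1; have [A2 q2] := ch2.
have [open1 _] := manifold_compatible manifoldX Ac A1.
have cK := chart_invK Ac cq.
apply: (transition_comp open1) => //; first by exists q.
- by move=> _ [z [cz c1z] <-]; rewrite chart_invK.
- exact: transition_differentiable.
Qed.

Lemma tangent_eq c q u v : chart_at A q c ->
  tangent_space A q u -> tangent_space A q v -> u c = v c -> u = v.
Proof.
move=> ch [u0 uc] [v0 vc] e; apply/funext => c'.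
have [ch'|nch'] := pselect (chart_at A q c'); last by rewrite u0 ?v0.
by rewrite (uc c) // (vc c) // e.
Qed.

Lemma tangent_space_linear q (a : R) u v :
  tangent_space A q u -> tangent_space A q v -> tangent_space A q (a *: u + v).
Proof.
move=> [u0 uc] [v0 vc]; split=> [c nch|c1 c2 ch1 ch2].
  by rewrite tangent_vectorE u0 // v0 // scaler0 addr0.
by rewrite !tangent_vectorE (uc c1) // (vc c1) // linearP.
Qed.

End ManifoldCharts.

Section SubmersionCharts.
Variables (R : realType) (V : normedModType R) (T : Type) (d : nat).
Variables (X : set T) (A : set (chart R T d)) (U : set V) (f : V -> T).
Hypotheses (manifoldX : smooth_manifold X A) (submersionf : smooth_submersion U X A f).
Implicit Types (c : chart R T d) (x v w : V).

Definition chart_preimage c : set V := U `&` f @^-1` chart_dom c.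

Lemma chart_preimage_open c : A c -> open (chart_preimage c).
Proof. by case: submersionf => -[_ H] _ /H[]. Qed.

Lemma chart_comp_smooth c : A c -> smooth_on (chart_preimage c) (c \o f).
Proof. by case: submersionf => -[_ H] _ /H[]. Qed.

Lemma chart_comp_differentiable c x : U x -> chart_at A (f x) c ->
  differentiable (c \o f) x.
Proof. by move=> Ux [Ac cx]; have [H _] := chart_comp_smooth Ac 1; apply: H. Qed.

Lemma mdiff_chart c x v : chart_at A (f x) c -> mdiff A f x v c = 'd (c \o f) x v.
Proof. by move=> ch; rewrite /mdiff; case: asboolP. Qed.

Lemma mdiff_tangent x v : U x -> tangent_space A (f x) (mdiff A f x v).
Proof.
move=> Ux; split=> [c nch|c1 c2 ch1 ch2]; first by rewrite /mdiff; case: asboolP.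
rewrite !mdiff_chart //; have [A1 x1] := ch1.
apply: (transition_comp manifoldX (chart_preimage_open A1)) => //.
- by move=> y [].
- exact: chart_comp_differentiable.
Qed.

Lemma mdiffP x (a : R) v w :
  mdiff A f x (a *: v + w) = a *: mdiff A f x v + mdiff A f x w.
Proof.
apply/funext => c; rewrite tangent_vectorE /mdiff.
by case: asboolP => _; rewrite ?linearP // scaler0 addr0.
Qed.

Lemma mdiff0 x : mdiff A f x 0 = 0.
Proof. by apply/funext => c; rewrite /mdiff; case: asboolP => // _; rewrite linear0. Qed.

Lemma mdiffB x v w : mdiff A f x (v - w) = mdiff A f x v - mdiff A f x w.
Proof.
by rewrite -[- w]scaleN1r addrC mdiffP scaleN1r addrC.
Qed.

Lemma mdiff_eqP c x v xi : U x -> chart_at A (f x) c -> tangent_space A (f x) xi ->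
  mdiff A f x v = xi <-> 'd (c \o f) x v = xi c.
Proof.
move=> Ux ch xiT; split=> [<-|e]; first by rewrite mdiff_chart.
by apply: (tangent_eq ch) => //; [exact: mdiff_tangent|rewrite mdiff_chart].
Qed.

(** Any coordinates are those of a tangent vector, so that the surjectivity of the
    differential between tangent spaces carries over to charts. *)
Lemma chart_comp_surj c x : U x -> chart_at A (f x) c ->
  set_surj [set: V] [set: 'rV[R]_d] ('d (c \o f) x).
Proof.
move=> Ux ch a _; have [_ /(_ x Ux) surj] := submersionf.
have [v _ ve] := surj _ (coord_vector_tangent manifoldX a ch).
exists v => //; rewrite -mdiff_chart // ve; exact: (coord_vector_chart manifoldX).
Qed.

Lemma chart_exists x : U x -> exists c, chart_at A (f x) c.
Proof.
move=> Ux; have [[fX _] _] := submersionf.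
by have [c Ac cx] := manifold_cover manifoldX (fX x Ux); exists c.
Qed.

(** In a chart the projection is constant along a curve drawn on a fibre. *)
Lemma velocities_fibre_ker x v : vertical U f x v -> U x -> mdiff A f x v = 0.
Proof.
move=> [gamma [e [e0 sg gU g0 ->]]]; case: x / g0 gU => gU Ux.
have [c ch] := chart_exists Ux.
apply/(mdiff_eqP _ Ux ch); first by split=> // *; rewrite linear0.
have open_e : open [set t : R^o | - e < t < e].
  rewrite (_ : [set t : R^o | _] = [set` `]- e, e[%R]); first exact: interval_open.
  by apply/seteqP; split=> t; rewrite /= in_itv.
have I0 : [set t : R^o | - e < t < e] 0 by rewrite /= oppr_lt0 e0.
have dg : differentiable gamma 0 by have [H _] := sg 1; apply: H.
rewrite derive1E' //.
have df := chart_comp_differentiable Ux ch.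
have near0 : \forall t \near (0 : R^o), cst (c (f (gamma 0))) t = ((c \o f) \o gamma) t.
  by apply: filterS (openU_near open_e I0) => t /gU [_ /= ->].
have D := (near_eq_diff near0 (differentiable_cst _ _)).2.
have D' := @diff_comp _ _ _ _ gamma (c \o f) (0 : R^o) dg df.
have D0 := @diff_cst _ (R^o : normedModType R) _ (c (f (gamma 0))) (0 : R^o).
exact: (congr1 (fun h : R^o -> 'rV[R]_d => h 1) (etrans (esym D') (etrans D D0))).
Qed.

Lemma diff_fibre_mdiff_ker (N : nat) (co : {linear V -> 'rV[R]_N})
    (E : {linear 'rV[R]_N -> V}) (W : normedModType R) (h : V -> W) x :
  cancel co E -> continuous co -> U x -> differentiable h x ->
  (forall y, U y -> f y = f x -> h y = h x) ->
  forall v, mdiff A f x v = 0 -> 'd h x v = 0.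
Proof.
move=> coK co_cont Ux dh hfib v; have [c ch] := chart_exists Ux.
have [Ac cx] := ch.
move/(mdiff_eqP _ Ux ch) => dv.
apply: (diff_fibre_ker coK co_cont (chart_preimage_open Ac) (chart_comp_smooth Ac 1)) => //.
- exact: chart_comp_surj.
- move=> y [Uy cy] /= e; apply: hfib => //.
  by rewrite -(chart_invK manifoldX Ac cy) e (chart_invK manifoldX).
- by apply: dv; split=> // *; rewrite linear0.
Qed.

End SubmersionCharts.

(** * The quotient of an invariant metric *)

(** A smooth submersion [f] and a metric [gU] such that the vertical spaces are
    the kernels of the differential and any two points of a fibre are exchanged
    by a linear isometry that preserves the fibres.  The metric has a smooth
    inverse, given by its matrix [Q] in the frame: E (r Q) is the vector that
    represents the linear form of coordinates r. *)
Section QuotientMetric.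
Variables (R : realType) (V : normedModType R) (N : nat).
Variables (co : {linear V -> 'rV[R]_N}) (E : {linear 'rV[R]_N -> V}).
Hypotheses (coK : cancel co E) (co_cont : continuous co).
Variables (T : Type) (d : nat) (X : set T) (A : set (chart R T d)).
Variables (U : set V) (f : V -> T).
Hypotheses (manifoldX : smooth_manifold X A) (submersionf : smooth_submersion U X A f).
Hypothesis (fX : X `<=` f @` U).

Variable gU : V -> V -> V -> R.
Hypothesis gU_linear : forall x (a : R) u v w,
  gU x (a *: u + v) w = a * gU x u w + gU x v w.
Hypothesis gU_sym : forall x, U x -> forall v w, gU x v w = gU x w v.
Hypothesis gU_pos : forall x, U x -> forall v, v <> 0 -> 0 < gU x v v.

Variable Q : V -> 'M[R]_N.
Hypothesis Q_smooth : forall k, CkMx setT k Q.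
Hypothesis gU_cometric : forall x, U x -> forall r v,
  gU x (E (r *m Q x)) v = (r *m (co v)^T) 0 0.

Hypothesis vertical_ker : forall x, U x ->
  vertical U f x = [set v | mdiff A f x v = 0].

Hypothesis fibre_isometry : forall x y, U x -> U y -> f x = f y ->
  exists L : {linear V -> V}, exists L' : V -> V,
    [/\ continuous L, cancel L' L, L x = y, (forall z, f (L z) = f z) &
        forall v w, gU y (L v) (L w) = gU x v w].

Local Notation D c := (frame_jacobian E (c \o f)).
Local Notation P c x := ((D c x)^T *m Q x *m D c x).
Local Notation lift := (horizontal_lift U A f gU).
Local Notation horiz := (horizontal U f gU).

Lemma gU0l x w : gU x 0 w = 0.
Proof.
have := gU_linear x 1 0 0 w.
rewrite scaler0 addr0 mul1r => /eqP.
by rewrite -subr_eq0 opprD addrA subrr sub0r oppr_eq0 => /eqP.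
Qed.

Lemma horizontalP x h : U x ->
  horiz x h <-> forall v, mdiff A f x v = 0 -> gU x h v = 0.
Proof. by move=> Ux; rewrite /horizontal /= vertical_ker. Qed.

Lemma horizontal_linear x (a : R) h k : horiz x h -> horiz x k -> horiz x (a *: h + k).
Proof. by move=> hh hk v vv; rewrite gU_linear hh // hk // mulr0 addr0. Qed.

Lemma horizontal_ker0 x h : U x -> horiz x h -> mdiff A f x h = 0 -> h = 0.
Proof.
move=> Ux /(horizontalP _ Ux) hh dh; apply: contrapT => h0.
by have := gU_pos Ux h0; rewrite hh // ltxx.
Qed.

Lemma horizontal_inj x h k : U x -> horiz x h -> horiz x k ->
  mdiff A f x h = mdiff A f x k -> h = k.
Proof.
move=> Ux hh hk e; apply/subr0_eq/(horizontal_ker0 Ux); last first.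
  by rewrite mdiffB e subrr.
by rewrite addrC -scaleN1r; apply: horizontal_linear.
Qed.

Section Chart.
Variable c : chart R T d.
Hypothesis Ac : A c.

Let open_c := chart_preimage_open submersionf Ac.
Let smooth_c := chart_comp_smooth submersionf Ac.
Let surj_c x : chart_preimage U f c x ->
  set_surj [set: V] [set: 'rV[R]_d] ('d (c \o f) x).
Proof. by move=> [Ux cx]; apply: (chart_comp_surj manifoldX submersionf Ux). Qed.

(** The vector E (u D^T Q) represents the linear form v |-> <u, 'd (c o f) x v>,
    which vanishes on the kernel: it is horizontal. *)
Lemma gU_grad x (u : 'rV[R]_d) v : U x ->
  gU x (E (u *m (D c x)^T *m Q x)) v = (u *m ('d (c \o f) x v)^T) 0 0.
Proof. by move=> Ux; rewrite gU_cometric // (diff_coE coK) trmx_mul mulmxA. Qed.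

Lemma diff_grad x (u : 'rV[R]_d) :
  'd (c \o f) x (E (u *m (D c x)^T *m Q x)) = u *m P c x.
Proof. by rewrite diff_frameE !mulmxA. Qed.

(** If u P = 0, then the vector that represents the form v |-> <u, 'd (c o f) x v> is
    both horizontal and in the kernel, so it is 0, and u = 0 by surjectivity. *)
Lemma cometric_unitmx x : chart_preimage U f c x -> P c x \in unitmx.
Proof.
move=> cx; have [Ux _] := cx; apply: row_inj_unitmx => u uP.
have uE : E (u *m (D c x)^T *m Q x) = 0.
  apply: contrapT => /(gU_pos Ux).
  by rewrite gU_grad // diff_grad uP trmx0 mulmx0 mxE ltxx.
have surj := surj_c cx; have [v _ dv] := surj u I.
apply: dotmx_eq0; apply/matrixP => i j; rewrite !ord1 -{2}dv -gU_grad // uE.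
by rewrite gU0l mxE.
Qed.

(** The horizontal lift of the tangent vector of coordinates [a] in the chart [c]. *)
Definition chart_lift x (a : 'rV[R]_d) : V :=
  E (a *m invmx (P c x) *m (D c x)^T *m Q x).

Lemma diff_chart_lift x a : chart_preimage U f c x ->
  'd (c \o f) x (chart_lift x a) = a.
Proof. by move=> cx; rewrite diff_grad mulmxKV // cometric_unitmx. Qed.

Lemma gU_chart_lift x a v : U x ->
  gU x (chart_lift x a) v = (a *m invmx (P c x) *m ('d (c \o f) x v)^T) 0 0.
Proof. exact: gU_grad. Qed.

Lemma chart_lift_lift x xi : chart_preimage U f c x -> tangent_space A (f x) xi ->
  horiz x (chart_lift x (xi c)) /\ mdiff A f x (chart_lift x (xi c)) = xi.
Proof.
move=> cx xiT; have [Ux cfx] := cx; have ch : chart_at A (f x) c by [].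
split; last first.
  by apply/(mdiff_eqP manifoldX submersionf _ Ux ch xiT); exact: diff_chart_lift.
apply/horizontalP => // v dv; rewrite gU_chart_lift // -(mdiff_chart _ ch) dv.
by rewrite [X in _ *m X^T](_ : _ = 0) // trmx0 mulmx0 mxE.
Qed.

End Chart.

Lemma liftP x xi : U x -> tangent_space A (f x) xi ->
  horiz x (lift x xi) /\ mdiff A f x (lift x xi) = xi.
Proof.
move=> Ux xiT; have [c [Ac cx]] := chart_exists manifoldX submersionf Ux.
rewrite /horizontal_lift; set S := [set h | _].
by apply: (@xgetPex _ 0 S); exists (chart_lift c x (xi c)); apply: chart_lift_lift.
Qed.

Lemma lift_unique x xi h : U x -> tangent_space A (f x) xi ->
  horiz x h -> mdiff A f x h = xi -> lift x xi = h.
Proof.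
move=> Ux xiT hh dh; have [hl dl] := liftP Ux xiT.
by apply: (horizontal_inj Ux) => //; rewrite dl dh.
Qed.

(** In a chart the quotient metric has matrix (D^T Q D)^-1: the inverse metric of
    the quotient is the image of the inverse metric of the total space. *)
Lemma gU_lift c x xi zeta : A c -> chart_preimage U f c x ->
  tangent_space A (f x) xi -> tangent_space A (f x) zeta ->
  gU x (lift x xi) (lift x zeta) =
    (xi c *m invmx (P c x) *m (zeta c)^T) 0 0.
Proof.
move=> Ac cx xiT zetaT; have [Ux cfx] := cx.
have [hx dx] := chart_lift_lift Ac cx xiT.
rewrite (lift_unique Ux xiT hx dx) gU_chart_lift //.
by have [_ {2}<-] := liftP Ux zetaT; rewrite mdiff_chart.
Qed.

(** An isometry that preserves the fibres maps kernels to kernels, hence horizontal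
    vectors to horizontal vectors, and does not change the image in the quotient. *)
Lemma lift_equivariant x y xi (L : {linear V -> V}) (L' : V -> V) : U x -> U y ->
  continuous L -> cancel L' L -> L x = y -> (forall z, f (L z) = f z) ->
  (forall v w, gU y (L v) (L w) = gU x v w) ->
  tangent_space A (f x) xi -> lift y xi = L (lift x xi).
Proof.
move=> Ux Uy Lc L'K Lxy fL gL xiT.
have fxy : f y = f x by rewrite -Lxy fL.
have dL v : mdiff A f y (L v) = mdiff A f x v.
  have [c chx] := chart_exists manifoldX submersionf Ux.
  have chy : chart_at A (f y) c by rewrite fxy.
  apply/(mdiff_eqP manifoldX submersionf _ Uy chy).
    rewrite fxy; exact: (mdiff_tangent manifoldX submersionf v Ux).
  rewrite mdiff_chart //.
  have cE : (c \o f) \o L = c \o f by apply/funext => z /=; rewrite fL.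
  have dc := chart_comp_differentiable submersionf Uy chy.
  have dLx : differentiable L x := linear_differentiable x Lc.
  case: y / Lxy dc {gL chy fxy Uy} => dc.
  have := @diff_comp _ _ _ _ L (c \o f) x dLx dc.
  rewrite cE => /(congr1 (fun h : V -> 'rV[R]_d => h v)) /= ->.
  by rewrite (diff_lin x Lc).
have [hl dl] := liftP Ux xiT.
apply: lift_unique => //; first by rewrite fxy.
  apply/horizontalP => // v; rewrite -(L'K v) dL gL.
  by move: hl => /(horizontalP _ Ux); apply.
by rewrite dL.
Qed.

Lemma lift_metric_invariant x y xi zeta : U x -> U y -> f x = f y ->
  tangent_space A (f x) xi -> tangent_space A (f x) zeta ->
  gU x (lift x xi) (lift x zeta) = gU y (lift y xi) (lift y zeta).
Proof.
move=> Ux Uy fxy xiT zetaT; have [L [L' [Lc L'K Lxy fL gL]]] := fibre_isometry Ux Uy fxy.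
by rewrite !(lift_equivariant Ux Uy Lc L'K Lxy fL gL).
Qed.

Variable g : T -> tangent_vector R T d -> tangent_vector R T d -> R.
Hypothesis gE : forall x, U x -> forall xi zeta,
  tangent_space A (f x) xi -> tangent_space A (f x) zeta ->
  g (f x) xi zeta = gU x (lift x xi) (lift x zeta).

Lemma lift_linear x (a : R) xi zeta : U x ->
  tangent_space A (f x) xi -> tangent_space A (f x) zeta ->
  lift x (a *: xi + zeta) = a *: lift x xi + lift x zeta.
Proof.
move=> Ux xiT zetaT; have [hx dx] := liftP Ux xiT; have [hz dz] := liftP Ux zetaT.
apply: lift_unique => //; first exact: tangent_space_linear.
  exact: horizontal_linear.
by rewrite mdiffP dx dz.
Qed.

Lemma quotient_riemannian_metric : riemannian_metric X A g.
Proof.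
split=> [q /fX [x Ux <-] a u v w uT vT wT|q /fX [x Ux <-] u v uT vT|
         q /fX [x Ux <-] u uT u0|c Ac a b].
- have auvT := tangent_space_linear a uT vT.
  by rewrite !gE // lift_linear // gU_linear.
- by rewrite !gE // gU_sym.
- rewrite gE //; apply: gU_pos => // l0; apply: u0.
  by have [_ <-] := liftP Ux uT; rewrite l0 mdiff0.
have sub_dom : chart_dom c `<=` X by have [] := manifold_chart manifoldX Ac.
have -> : chart_img c = (c \o f) @` chart_preimage U f c.
  apply/seteqP; split=> [_ [q cq <-]|_ [x [Ux cx] <-]]; last by exists (f x).
  have [x Ux fxq] := fX (sub_dom q cq).
  by exists x => //=; [split=> //=; rewrite fxq|rewrite fxq].
have open_c := chart_preimage_open submersionf Ac.
have smooth_c := chart_comp_smooth submersionf Ac.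
have surj_c x : chart_preimage U f c x ->
    set_surj [set: V] [set: 'rV[R]_d] ('d (c \o f) x).
  by move=> [Ux cx]; apply: (chart_comp_surj manifoldX submersionf Ux).
(* It remains to see that the metric at f x is smooth in x. *)
apply: (descent_smooth coK co_cont open_c smooth_c surj_c) => k.
have sD := frame_jacobian_smooth E open_c smooth_c k.
have sP : CkMx (chart_preimage U f c) k (fun x => P c x).
  apply: CkMxM => //; apply: CkMxM => //; first exact: CkMx_tr.
  by move=> i j; apply: (sub_Ck _ (Q_smooth k i j)).
have H : CkMx (chart_preimage U f c) k (fun x => a *m invmx (P c x) *m b^T).
  apply: CkMxM => //; last exact: CkMx_cst.
  apply: CkMxM => //; first exact: CkMx_cst.
  by apply: CkMx_inv => // x; apply: cometric_unitmx.
apply: (eq_Ck open_c) (H 0 0) => x /set_mem cx; have [Ux cfx] := cx.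
rewrite /= (chart_invK manifoldX Ac cfx).
have ch : chart_at A (f x) c by [].
have cT e := coord_vector_tangent manifoldX e ch.
by rewrite gE // (gU_lift Ac cx) // !(coord_vector_chart manifoldX).
Qed.

Lemma quotient_riemannian_submersion : riemannian_submersion U X A f gU g.
Proof.
split=> // x Ux; split=> [|a h k _ _|h k hh hk]; last 2 first.
- exact: mdiffP.
- have hT := mdiff_tangent manifoldX submersionf h Ux.
  have kT := mdiff_tangent manifoldX submersionf k Ux.
  rewrite gE //; congr (gU x _ _); exact: lift_unique.
split=> [h _|h k /set_mem hh /set_mem hk|xi xiT].
- exact: (mdiff_tangent manifoldX submersionf h Ux).
- exact: (horizontal_inj Ux).
- by have [hl dl] := liftP Ux xiT; exists (lift x xi).
Qed.

End QuotientMetric.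

(** * Differentials of matrix-valued maps *)

Lemma frame_linear_continuous (R : realType) (V W : normedModType R) (N : nat)
    (co : {linear V -> 'rV[R]_N}) (E : {linear 'rV[R]_N -> V}) (L : {linear V -> W}) :
  cancel co E -> continuous co -> continuous L.
Proof.
move=> coK /linear_lipschitz [c c0 coc].
pose M := \sum_i `|L (E (delta_mx 0 i))|.
apply: (@lipschitz_linear_continuous R V W L (c * M)) => v.
rewrite [in leLHS](frame_sum coK v) linear_sum; apply: (le_trans (ler_norm_sum _ _ _)).
rewrite mulrAC mulr_sumr; apply: ler_sum => i _.
rewrite linearZZ normrZ ler_wpM2r //; exact: le_trans (norm_entry _ _ _) (coc v).
Qed.

Section MatrixDiff.
Variables (R : realType) (V : normedModType R).

Definition diffble_mx a b (M : V -> 'M[R]_(a, b)) (x : V) : Prop :=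
  forall i j, differentiable (fun y => M y i j : R^o) x.

Definition diff_mx a b (M : V -> 'M[R]_(a, b)) (x v : V) : 'M[R]_(a, b) :=
  \matrix_(i, j) 'd (fun y => M y i j : R^o) x v.

Lemma CkMx_diffble (U : set V) a b (M : V -> 'M[R]_(a, b)) x :
  U x -> CkMx U 1 M -> diffble_mx M x.
Proof. by move=> Ux sM i j; apply: (sM i j).1. Qed.

Lemma diff_mx_cst a b (M : 'M[R]_(a, b)) x v : diff_mx (fun=> M) x v = 0.
Proof. by apply/matrixP => i j; rewrite !mxE (diff_cst (M i j : R^o) x). Qed.

Lemma diff_mx_tr a b (M : V -> 'M[R]_(a, b)) x v :
  diff_mx (fun y => (M y)^T) x v = (diff_mx M x v)^T.
Proof. by apply/matrixP => i j; rewrite !mxE; under eq_fun do rewrite mxE. Qed.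

Lemma diff_mxM a b c (M : V -> 'M[R]_(a, b)) (M' : V -> 'M[R]_(b, c)) x v :
  diffble_mx M x -> diffble_mx M' x ->
  diff_mx (fun y => M y *m M' y) x v =
    diff_mx M x v *m M' x + M x *m diff_mx M' x v.
Proof.
move=> dM dM'; apply/matrixP => i j; rewrite [RHS]mxE.
rewrite [X in _ = X + _]mxE [X in _ = _ + X]mxE -big_split.
rewrite mxE; under eq_fun do rewrite mxE.
pose h l : V -> R^o := fun y => M y i l * M' y l j.
have dh l : differentiable (h l) x := differentiableM (dM i l) (dM' l j).
have dS : 'd (\sum_l h l) x v = \sum_l 'd (h l) x v.
  suff : differentiable (\sum_l h l) x /\ 'd (\sum_l h l) x v = \sum_l 'd (h l) x v by case.
  apply: (big_rec2 (fun (p : V -> R^o) s => differentiable p x /\ 'd p x v = s)).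
    split; first exact: (differentiable_cst (0 : R^o) x).
    exact: (congr1 (fun h : V -> R^o => h v) (diff_cst (0 : R^o) x)).
  move=> l p s _ [dp <-]; split; first exact: differentiableD (dh l) dp.
  exact: (congr1 (fun h : V -> R^o => h v) (diffD (dh l) dp)).
have -> : (fun y => \sum_l M y i l * M' y l j : R^o) = \sum_l h l.
  by apply/funext => y; rewrite fct_sumE.
rewrite dS; apply: eq_bigr => l _; rewrite !mxE.
have -> : 'd (h l) x v = M x i l * 'd (fun y => M' y l j : R^o) x v +
    M' x l j * 'd (fun y => M y i l : R^o) x v.
  exact: (congr1 (fun h : V -> R^o => h v) (diffM (dM i l) (dM' l j))).
by rewrite addrC [X in X + _]mulrC.
Qed.

Lemma diff_mx_linear (W : normedModType R) a b (p : V -> W)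
    (L : {linear W -> 'M[R]_(a, b)}) x v : continuous L -> differentiable p x ->
  diff_mx (fun y => L (p y)) x v = L ('d p x v).
Proof.
move=> Lc dp; apply/matrixP => i j; rewrite mxE.
have dL := linear_differentiable (p x) Lc.
have dLp := @differentiable_comp _ _ _ _ p L x dp dL.
have cc := @mx_coord_continuous R a b i j.
have D := @diff_comp _ _ _ _ (L \o p) (@mx_coord R a b i j) x dLp
  (linear_differentiable _ cc).
have D' := @diff_comp _ _ _ _ p L x dp dL.
apply: (etrans (congr1 (fun h : V -> R^o => h v) D)).
rewrite /= (diff_lin _ cc) (congr1 (fun h : V -> 'M[R]_(a, b) => h v) D') /=.
by rewrite (diff_lin _ Lc).
Qed.

End MatrixDiff.

(** * Trace forms and positive definite matrices *)

Section TraceForm.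
Variable R : realType.

Lemma trace_mulTmx a b (M M' : 'M[R]_(a, b)) :
  \tr (M^T *m M') = \sum_i \sum_j M i j * M' i j.
Proof.
rewrite exchange_big /mxtrace; apply: eq_bigr => j _; rewrite mxE.
by apply: eq_bigr => i _; rewrite mxE.
Qed.

Lemma mxvec_dot a b (M M' : 'M[R]_(a, b)) :
  (mxvec M *m (mxvec M')^T) 0 0 = \tr (M^T *m M').
Proof.
rewrite trace_mulTmx mxE pair_bigA /=.
rewrite (reindex _ (curry_mxvec_bij a b)) /=; apply: eq_bigr => -[i j] _ /=.
by rewrite mxE !mxvecE.
Qed.

Lemma trace_form_ge0 a b (M : 'M[R]_(a, b)) : 0 <= \tr (M^T *m M).
Proof.
by rewrite trace_mulTmx; do 2![apply: sumr_ge0 => ? _]; rewrite -expr2 sqr_ge0.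
Qed.

Lemma trace_form_eq0 a b (M : 'M[R]_(a, b)) : \tr (M^T *m M) = 0 -> M = 0.
Proof.
rewrite -mxvec_dot => h; apply: (can_inj (@mxvecK _ _ _)); rewrite linear0.
by apply: dotmx_eq0; apply/matrixP => i j; rewrite !ord1 h mxE.
Qed.

Lemma posdef_unitmx n (S : 'M[R]_n) : posdefmx S -> S \in unitmx.
Proof.
move=> Spos; apply: row_inj_unitmx => u uS; apply: contrapT => u0.
have /Spos : u^T != 0.
  by apply/eqP => /(congr1 trmx); rewrite trmxK trmx0.
by rewrite trmxK uS mul0mx mxE ltxx.
Qed.

Lemma posdef_inv n (S : 'M[R]_n) : S^T = S -> posdefmx S -> posdefmx (invmx S).
Proof.
move=> Ssym Spos x x0; have uS := posdef_unitmx Spos.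
have y0 : invmx S *m x != 0.
  apply: contra x0 => /eqP e; apply/eqP.
  by rewrite -[x](mulKVmx uS) e mulmx0.
have := Spos _ y0; rewrite trmx_mul trmx_inv Ssym !mulmxA.
by rewrite mulmxKV.
Qed.

(** Cholesky factorization, by induction on the size.  The Schur complement D' of
    the first entry a is again positive definite: its quadratic form at y is that
    of S at the vector (z, y) with z = - a^-1 b^T y. *)
Lemma posdef_factor n (S : 'M[R]_n) : S^T = S -> posdefmx S ->
  exists L : 'M[R]_n, S = L *m L^T.
Proof.
elim: n S => [|n IH] S Ssym Spos; first by exists 0; apply/matrixP => -[].
pose S' : 'M[R]_(1 + n) := S.
pose a := S 0 0; pose b : 'M[R]_(n, 1) := dlsubmx S'; pose D : 'M[R]_n := drsubmx S'.
have SE : S' = block_mx a%:M b^T b D.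
  rewrite -[LHS]submxK; congr block_mx.
    by apply/matrixP => i j; rewrite !ord1 !mxE /a /S' !lshift0.
  apply/matrixP => i j; rewrite !mxE /S'.
  by have /matrixP /(_ (lshift n i) (rshift 1 j)) := Ssym; rewrite mxE.
have quad (z : 'cV[R]_1) (y : 'cV[R]_n) :
    (col_mx z y)^T *m S' *m col_mx z y =
    z^T *m a%:M *m z + y^T *m b *m z + z^T *m b^T *m y + y^T *m D *m y.
  rewrite SE tr_col_mx mul_row_block mul_row_col !mulmxDl.
  by rewrite addrA.
have pos (z : 'cV[R]_1) (y : 'cV[R]_n) : col_mx z y != 0 -> 0 <
    (z^T *m a%:M *m z + y^T *m b *m z + z^T *m b^T *m y + y^T *m D *m y) 0 0.
  by move=> nz; rewrite -quad; exact: (Spos _ nz).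
have a0 : 0 < a.
  have nz : col_mx (1%:M : 'M[R]_1) (0 : 'cV[R]_n) != 0.
    apply/eqP => /matrixP /(_ (lshift n 0) 0); rewrite col_mxEu !mxE eqxx => /eqP.
    by rewrite oner_eq0.
  have := pos _ _ nz.
  by rewrite trmx0 !mul0mx mulmx0 !addr0 trmx1 mul1mx mulmx1 mxE.
pose D' := D - a^-1 *: (b *m b^T).
have Dsym : D^T = D by rewrite /D trmx_drsub Ssym.
have D'sym : D'^T = D' by rewrite /D' linearB linearZ /= Dsym trmx_mul trmxK.
have D'pos : posdefmx D'.
  move=> y y0; pose z : 'cV[R]_1 := - a^-1 *: (b^T *m y).
  have nz : col_mx z y != 0.
    apply: contra y0 => /eqP e; apply/eqP.
    by rewrite -[y](col_mxKd z) e linear0.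
  have := pos _ _ nz.
  suff -> : z^T *m a%:M *m z + y^T *m b *m z + z^T *m b^T *m y + y^T *m D *m y
     = y^T *m D' *m y by [].
  have zT : z^T = - a^-1 *: (y^T *m b) by rewrite linearZ /= trmx_mul trmxK.
  rewrite zT /z /D' mul_mx_scalar scalerA mulrN mulfV ?gt_eqF // scaleN1r.
  rewrite mulNmx addNr add0r.
  rewrite mulmxBr mulmxBl -!scalemxAl -scalemxAr -scalemxAl !mulmxA addrC scaleNr.
  by [].
have [L' L'E] := IH D' D'sym D'pos.
pose s := Num.sqrt a.
have s2 : s * s = a by rewrite -expr2 sqr_sqrtr // ltW.
have s0 : s != 0 by rewrite gt_eqF // sqrtr_gt0.
pose L : 'M[R]_(1 + n) := block_mx s%:M 0 (s^-1 *: b) L'.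
exists L; change (S' = L *m L^T).
rewrite SE /L tr_block_mx mulmx_block !trmx0 !mulmx0 !mul0mx !addr0 tr_scalar_mx.
rewrite -scalar_mxM s2 mul_scalar_mx linearZ /= scalerA mulfV // scale1r.
rewrite mul_mx_scalar scalerA mulfV // scale1r -L'E /D'.
rewrite -scalemxAl -scalemxAr scalerA -invfM s2 addrC subrK.
by [].
Qed.

(** If S = L L^T, then tr (S X S X) is the squared Frobenius norm of L^T X L. *)
Lemma trace_form_pos n (S X : 'M[R]_n) : S^T = S -> posdefmx S -> X^T = X -> X != 0 ->
  0 < \tr (S *m X *m S *m X).
Proof.
move=> Ssym Spos Xsym X0; have [L SE] := posdef_factor Ssym Spos.
have uL : L \in unitmx.
  have := posdef_unitmx Spos; rewrite SE !unitmxE det_mulmx det_tr.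
  by rewrite unitrM => /andP[].
pose Y := L^T *m X *m L.
have Ysym : Y^T = Y by rewrite /Y !trmx_mul trmxK Xsym mulmxA.
have -> : \tr (S *m X *m S *m X) = \tr (Y^T *m Y).
  rewrite Ysym /Y SE.
  have -> : L *m L^T *m X *m (L *m L^T) *m X =
      L *m (L^T *m X *m L *m L^T *m X) by rewrite !mulmxA.
  by rewrite mxtrace_mulC !mulmxA.
rewrite lt_neqAle trace_form_ge0 andbT eq_sym; apply: contra X0 => /eqP/trace_form_eq0 Y0.
have uLT : L^T \in unitmx by rewrite unitmx_tr.
have -> : X = invmx L^T *m Y *m invmx L by rewrite /Y !mulmxA mulVmx // mul1mx mulmxK.
by rewrite Y0 mulmx0 mul0mx.
Qed.

End TraceForm.

(** * Coordinates on the space of triples *)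

Section TripleFrame.
Variables (R : realType) (n m p : nat).
Local Notation V := (triple R n m p).
Local Notation N := (n * n + n * m + p * n)%N.

(** Valued in ['M_n], closed under products, rather than in [sym]. *)
Definition symA (x : V) : 'M[R]_n := mxA x.

Lemma symA_is_linear : linear symA. Proof. by []. Qed.
HB.instance Definition _ :=
  GRing.isLinear.Build R V 'M[R]_n *:%R symA symA_is_linear.

Lemma mxB_is_linear : linear (@mxB R n m p). Proof. by []. Qed.
HB.instance Definition _ :=
  GRing.isLinear.Build R V 'M[R]_(n, m) *:%R (@mxB R n m p) mxB_is_linear.

Lemma mxC_is_linear : linear (@mxC R n m p). Proof. by []. Qed.
HB.instance Definition _ :=
  GRing.isLinear.Build R V 'M[R]_(p, n) *:%R (@mxC R n m p) mxC_is_linear.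

Lemma symA_tr (x : V) : (symA x)^T = symA x.
Proof. by rewrite /symA; case: (mxA x) => S /= /eqP. Qed.

Lemma triple_eq (x y : V) :
  symA x = symA y -> mxB x = mxB y -> mxC x = mxC y -> x = y.
Proof.
case: x y => [[a b] c] [[a' b'] c'] /= => /val_inj.
by rewrite /mxA /mxB /mxC /= => -> -> ->.
Qed.

Definition triple_coord (x : V) : 'rV[R]_N :=
  row_mx (row_mx (mxvec (symA x)) (mxvec (mxB x))) (mxvec (mxC x)).

Lemma triple_coord_is_linear : linear triple_coord.
Proof.
move=> a x y; rewrite /triple_coord !linearP /=.
by rewrite !scale_row_mx !add_row_mx.
Qed.
HB.instance Definition _ :=
  GRing.isLinear.Build R V 'rV[R]_N *:%R triple_coord triple_coord_is_linear.

Lemma symmetrize_subproof (M : 'M[R]_n) : 2^-1 *: (M + M^T) \in @symmx R n.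
Proof. by rewrite unfold_in linearZ /= linearD /= trmxK addrC. Qed.

Definition symmetrize (M : 'M[R]_n) : sym R n := Sym (symmetrize_subproof M).

(** The first block of coordinates is symmetrized, that is, projected orthogonally
    for the trace form; hence [frame_dot]. *)
Definition triple_frame (r : 'rV[R]_N) : V :=
  (symmetrize (vec_mx (lsubmx (lsubmx r))), vec_mx (rsubmx (lsubmx r)),
   vec_mx (rsubmx r)).

Lemma triple_frame_is_linear : linear triple_frame.
Proof.
move=> a r s; apply: triple_eq; rewrite ?linearP //=.
- by apply/matrixP => i j; rewrite /symA /= !mxE; ring.
- by rewrite /mxB /= !linearP.
- by rewrite /mxC /= !linearP.
Qed.
HB.instance Definition _ :=
  GRing.isLinear.Build R 'rV[R]_N V *:%R triple_frame triple_frame_is_linear.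

Lemma triple_coordK : cancel triple_coord triple_frame.
Proof.
move=> x; apply: triple_eq; rewrite /triple_frame /triple_coord ?row_mxKl ?row_mxKr.
- by rewrite /symA /= mxvecK symA_tr; apply/matrixP => i j; rewrite !mxE; field.
- by rewrite /mxB /= mxvecK.
- by rewrite /mxC /= mxvecK.
Qed.

(** A property of scalar functions that holds for the entries of the three
    components holds for all coordinates; it is applied to bounds and to
    smoothness. *)
Lemma triple_coord_entryP (W : Type) (S : (W -> R) -> Prop) (g : W -> V) :
  (forall i j, S (fun w => symA (g w) i j)) ->
  (forall i j, S (fun w => mxB (g w) i j)) ->
  (forall i j, S (fun w => mxC (g w) i j)) ->
  forall j, S (fun w => triple_coord (g w) 0 j).
Proof.
move=> SA SB SC j; rewrite /triple_coord.
case: (split_ordP j) => [j' ->|k ->]; last first.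
  under eq_fun do rewrite row_mxEr.
  by case/mxvec_indexP: k => i l; under eq_fun do rewrite mxvecE.
under eq_fun do rewrite row_mxEl.
case: (split_ordP j') => k ->.
  under eq_fun do rewrite row_mxEl.
  by case/mxvec_indexP: k => i l; under eq_fun do rewrite mxvecE.
under eq_fun do rewrite row_mxEr.
by case/mxvec_indexP: k => i l; under eq_fun do rewrite mxvecE.
Qed.

Lemma triple_norm (x : V) :
  [/\ `|symA x| <= `|x|, `|mxB x| <= `|x| & `|mxC x| <= `|x|].
Proof.
case: x => [[a b] c]; rewrite /symA /mxA /mxB /mxC /=.
have -> : `|(a, b, c) : V| = Num.max (Num.max `|sym_val a| `|b|) `|c| by [].
by rewrite !le_max !lexx ?orbT.
Qed.

Lemma triple_coord_continuous : continuous triple_coord.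
Proof.
apply: (@lipschitz_linear_continuous _ _ _ triple_coord 1) => x; rewrite mul1r.
have [xA xB xC] := triple_norm x.
apply: norm_mx_le => // i j; rewrite ord1.
apply: (@triple_coord_entryP unit (fun h => `|h tt| <= `|x|) (fun=> x)) => k l;
  exact: le_trans (norm_entry _ _ _) _.
Qed.

Lemma triple_linear_continuous (W : normedModType R) (L : {linear V -> W}) : continuous L.
Proof. exact: frame_linear_continuous triple_coordK triple_coord_continuous. Qed.

Lemma triple_Ck (W : normedModType R) (O : set W) k (g : W -> V) : open O ->
  CkMx O k (fun w => symA (g w)) -> CkMx O k (fun w => mxB (g w)) ->
  CkMx O k (fun w => mxC (g w)) -> Ck k O g.
Proof.
move=> openO sA sB sC.
have -> : g = fun w => \sum_i triple_coord (g w) 0 i *: triple_frame (delta_mx 0 i).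
  by apply/funext => w; rewrite -(frame_sum triple_coordK).
apply: Ck_sum => // i; apply: Ck_scale => //.
exact: (@triple_coord_entryP W (fun h => Ck k O (h : W -> R^o)) g).
Qed.

End TripleFrame.

(** * The metric and its inverse *)

Section TripleMetric.
Variables (R : realType) (n m p : nat).
Local Notation V := (triple R n m p).
Local Notation N := (n * n + n * m + p * n)%N.
Local Notation co := (@triple_coord R n m p).
Local Notation E := (@triple_frame R n m p).

Lemma metricNE (x v w : V) : metricN x v w =
  \tr (invmx (symA x) *m symA v *m invmx (symA x) *m symA w)
  + \tr ((mxB v)^T *m mxB w) + \tr ((mxC v)^T *m mxC w).
Proof. by []. Qed.

Lemma metricN_linear (x : V) (a : R) (u v w : V) :
  metricN x (a *: u + v) w = a * metricN x u w + metricN x v w.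
Proof.
rewrite !metricNE (symA_is_linear a u v) (mxB_is_linear a u v) (mxC_is_linear a u v).
rewrite ![(_ + _)^T]linearP /= !mulmxDr !mulmxDl -!scalemxAr -!scalemxAl.
by rewrite !mxtraceD !mxtraceZ; ring.
Qed.

Lemma metricN_sym (x v w : V) : metricN x v w = metricN x w v.
Proof.
have trC a b (M M' : 'M[R]_(a, b)) : \tr (M^T *m M') = \tr (M'^T *m M).
  by rewrite -mxtrace_tr trmx_mul trmxK.
rewrite !metricNE (trC _ _ (mxB v)) (trC _ _ (mxC v)); congr (_ + _ + _).
by rewrite -!mulmxA mulmxA mxtrace_mulC !mulmxA.
Qed.

Lemma metricN_pos (x v : V) : spaceM x -> v <> 0 -> 0 < metricN x v v.
Proof.
move=> xpos v0; rewrite metricNE ltNge; apply/negP => le0; apply: v0.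
have Spos := posdef_inv (symA_tr x) xpos.
have Ssym : (invmx (symA x))^T = invmx (symA x) by rewrite trmx_inv symA_tr.
have B0 := trace_form_ge0 (mxB v); have C0 := trace_form_ge0 (mxC v).
have A0 : symA v = 0.
  apply/eqP; apply: contraTT le0 => vA; rewrite -ltNge.
  have := trace_form_pos Ssym Spos (symA_tr v) vA; lra.
move: le0; rewrite A0 mulmx0 mxtrace0 => le0.
apply: triple_eq; rewrite ?A0 ?linear0 //; apply: trace_form_eq0; lra.
Qed.

(** The inverse of the metric: it maps the vector that represents a linear form for
    the flat trace product to the one that represents it for the metric at [x]. *)
Definition sharp (x v : V) : V := (sym_conj (mxA x) (mxA v), mxB v, mxC v).

Lemma symA_sharp x v : symA (sharp x v) = symA x *m symA v *m symA x.
Proof.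
transitivity ((symA x)^T *m symA v *m symA x) => //.
by rewrite symA_tr.
Qed.

Lemma sharp_is_linear x : linear (sharp x).
Proof.
move=> a u v; apply: triple_eq.
- rewrite symA_sharp !symA_is_linear mulmxDr mulmxDl -scalemxAr -scalemxAl.
  by rewrite -!symA_sharp.
- exact: mxB_is_linear.
- exact: mxC_is_linear.
Qed.
HB.instance Definition _ x :=
  GRing.isLinear.Build R V V *:%R (sharp x) (sharp_is_linear x).

Definition cometric (x : V) : 'M[R]_N := lin1_mx (co \o sharp x \o E).

Lemma frame_cometric x r : E (r *m cometric x) = sharp x (E r).
Proof. by rewrite mul_rV_lin1 /= triple_coordK. Qed.

(** The trace product of a symmetric matrix with M is that with the symmetrization
    of M. *)
Lemma frame_dot r v : (r *m (co v)^T) 0 0 =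
  \tr ((symA (E r))^T *m symA v) + \tr ((mxB (E r))^T *m mxB v)
  + \tr ((mxC (E r))^T *m mxC v).
Proof.
have dot a b (s : 'rV[R]_(a * b)) (M : 'M[R]_(a, b)) :
    (s *m (mxvec M)^T) 0 0 = \tr ((vec_mx s)^T *m M).
  by rewrite -mxvec_dot vec_mxK.
rewrite -[r in LHS]hsubmxK -[lsubmx r in LHS]hsubmxK /triple_coord.
rewrite !tr_row_mx !mul_row_col [LHS]mxE [X in X + _]mxE !dot; congr (_ + _ + _).
set M := vec_mx _; have -> : symA (E r) = 2^-1 *: (M + M^T) by [].
rewrite linearZ /= linearD /= trmxK -scalemxAl mulmxDl mxtraceZ mxtraceD.
have -> : \tr (M *m symA v) = \tr (M^T *m symA v).
  by rewrite -[LHS]mxtrace_tr trmx_mul symA_tr mxtrace_mulC.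
by field.
Qed.

Lemma metricN_sharp x u v : spaceM x -> metricN x (sharp x u) v =
  \tr ((symA u)^T *m symA v) + \tr ((mxB u)^T *m mxB v) + \tr ((mxC u)^T *m mxC v).
Proof.
move=> /posdef_unitmx uA; rewrite metricNE symA_sharp symA_tr.
by rewrite !mulmxA mulVmx // mul1mx mulmxK.
Qed.

Lemma cometric_smooth k : CkMx setT k cometric.
Proof.
move=> i j; under eq_fun do rewrite mxE /=.
set u := E _.
have sA : CkMx [set: V] k (@symA R n m p).
  apply: (Ck_entry openT); apply: Ck_linear.
  exact: triple_linear_continuous.
pose S (h : V -> R) := Ck k setT (h : V -> R^o).
move: j; apply: (@triple_coord_entryP R n m p V S (sharp^~ u)) => a b; rewrite /S.
- under eq_fun do rewrite symA_sharp.
  have H : CkMx [set: V] k (fun w => symA w *m symA u *m symA w).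
    apply: (CkMxM openT) => //; apply: (CkMxM openT) => //; exact: CkMx_cst.
  exact: H.
- exact: Ck_cst.
- exact: Ck_cst.
Qed.

End TripleMetric.

(** * The action of the orthogonal group *)

Section Action.
Variables (R : realType) (n m p : nat).
Local Notation V := (triple R n m p).
Local Notation f := (@On_orbit R n m p).
Local Notation spaceN := (@spaceN R n m p).
Implicit Types (U : 'M[R]_n) (x y v w : V).

Lemma orthoT U : orthogonal_group U -> U *m U^T = 1%:M.
Proof. exact: mulmx1C. Qed.

Lemma symA_action U x : symA (On_action U x) = U^T *m symA x *m U.
Proof. by []. Qed.

Lemma On_action_is_linear U : linear (@On_action R n m p U).
Proof.
move=> a x y; apply: triple_eq.
- rewrite symA_action !symA_is_linear mulmxDr mulmxDl -scalemxAr -scalemxAl.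
  by rewrite -!symA_action.
- by rewrite mxB_is_linear /mxB /= -/(mxB _) -/(mxB _) mulmxDr scalemxAr.
- by rewrite mxC_is_linear /mxC /= -/(mxC _) -/(mxC _) mulmxDl scalemxAl.
Qed.
HB.instance Definition _ U :=
  GRing.isLinear.Build R V V *:%R (On_action U) (On_action_is_linear U).

Lemma On_action_comp U U' x : On_action U (On_action U' x) = On_action (U' *m U) x.
Proof.
apply: triple_eq.
- by rewrite !symA_action trmx_mul !mulmxA.
- by rewrite /mxB /= trmx_mul mulmxA.
- by rewrite /mxC /= mulmxA.
Qed.

Lemma On_action1 x : On_action 1%:M x = x.
Proof.
apply: triple_eq; first by rewrite symA_action trmx1 mul1mx mulmx1.
- by rewrite /mxB /= trmx1 mul1mx.
- by rewrite /mxC /= mulmx1.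
Qed.

Lemma orthogonal_tr U : orthogonal_group U -> orthogonal_group U^T.
Proof. by move=> oU; rewrite /orthogonal_group /= trmxK orthoT. Qed.

Lemma orthogonal_mul U U' : orthogonal_group U -> orthogonal_group U' ->
  orthogonal_group (U *m U').
Proof.
move=> oU oU'; rewrite /orthogonal_group /= trmx_mul mulmxA -(mulmxA U'^T).
by rewrite (_ : U^T *m U = 1%:M) // mulmx1.
Qed.

Lemma On_actionK U : orthogonal_group U ->
  cancel (@On_action R n m p U^T) (On_action U).
Proof. by move=> oU x; rewrite On_action_comp oU On_action1. Qed.

Lemma On_orbit_action U x : orthogonal_group U -> f (On_action U x) = f x.
Proof.
move=> oU; apply/seteqP; split=> _ [U' oU' <-].
  by exists (U *m U'); [exact: orthogonal_mul|rewrite On_action_comp].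
exists (U^T *m U'); first by apply: orthogonal_mul => //; exact: orthogonal_tr.
by rewrite On_action_comp mulmxA orthoT // mul1mx.
Qed.

Lemma On_orbit_eq x y : f x = f y -> exists2 U, orthogonal_group U & y = On_action U x.
Proof.
move=> e; have : f y y.
  by exists 1%:M; [rewrite /orthogonal_group /= trmx1 mul1mx|rewrite On_action1].
by rewrite -e => -[U oU <-]; exists U.
Qed.

(** Changing the coordinates of the state space conjugates the trajectories. *)
Lemma state_action U (A : 'M[R]_n) (B : 'M[R]_(n, m)) u (x0 : 'cV[R]_n) k :
  orthogonal_group U ->
  state (U^T *m A *m U) (U^T *m B) u x0 k = U^T *m state A B u (U *m x0) k.
Proof.
move=> oU; elim: k => [|k IH] /=; first by rewrite mulmxA oU mul1mx.
by rewrite IH mulmxDr !mulmxA -(mulmxA _ U U^T) orthoT // mulmx1.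
Qed.

Lemma spaceN_action U x : orthogonal_group U -> spaceN x -> spaceN (On_action U x).
Proof.
move=> oU [posx cx ox].
have Uinj (z z' : 'cV[R]_n) : U *m z = U *m z' -> z = z'.
  by move=> e; rewrite -[z]mul1mx -[z']mul1mx -oU -!mulmxA e.
split.
- move=> z z0; have Uz0 : U *m z != 0.
    by apply: contra z0 => /eqP e; apply/eqP/Uinj; rewrite e mulmx0.
  by have := posx _ Uz0; rewrite trmx_mul !mulmxA.
- move=> x0 x1; have [u [K e]] := cx (U *m x0) (U *m x1).
  by exists u, K; rewrite [LHS]state_action // e mulmxA oU mul1mx.
- move=> u x0 x0' e; apply: Uinj; apply: (ox u) => k.
  have := e k; rewrite [X in _ *m X = _]state_action // [X in _ = _ *m X]state_action //.
  by rewrite -!mulmxA !(mulmxA U) orthoT // !mul1mx.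
Qed.

Lemma metricN_action U x v w : orthogonal_group U -> spaceN x ->
  metricN (On_action U x) (On_action U v) (On_action U w) = metricN x v w.
Proof.
move=> oU [/posdef_unitmx uA _ _]; have oUT := orthoT oU.
rewrite !metricNE !symA_action.
have -> : invmx (U^T *m symA x *m U) = U^T *m invmx (symA x) *m U.
  have H : (U^T *m invmx (symA x) *m U) *m (U^T *m symA x *m U) = 1%:M.
    by rewrite !mulmxA -(mulmxA _ U U^T) oUT mulmx1 mulmxKV.
  have [_ uM] := mulmx1_unit H.
  by rewrite -[RHS](mulmxK uM) H mul1mx.
congr (_ + _ + _).
- set S := invmx _.
  have -> : U^T *m S *m U *m (U^T *m symA v *m U) *m (U^T *m S *m U)
       *m (U^T *m symA w *m U) =
     U^T *m (S *m symA v *m S *m symA w *m U).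
    by rewrite !mulmxA -!(mulmxA _ U U^T) oUT !mulmx1.
  by rewrite mxtrace_mulC -(mulmxA _ U U^T) oUT mulmx1.
- by rewrite /mxB /= trmx_mul trmxK mulmxA -(mulmxA _ U U^T) oUT mulmx1.
- by rewrite /mxC /= trmx_mul -mulmxA mxtrace_mulC !mulmxA -(mulmxA _ U U^T) oUT mulmx1.
Qed.

Lemma orbit_isometry x y : spaceN x -> spaceN y -> f x = f y ->
  exists L : {linear V -> V}, exists L' : V -> V,
    [/\ continuous L, cancel L' L, L x = y, (forall z, f (L z) = f z) &
        forall v w, metricN y (L v) (L w) = metricN x v w].
Proof.
move=> Nx Ny /On_orbit_eq [U oU yE]; exists (On_action U), (On_action U^T); split.
- exact: triple_linear_continuous.
- exact: On_actionK.
- by [].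
- by move=> z; apply: On_orbit_action.
- by move=> v w; rewrite yE metricN_action.
Qed.

End Action.

(** * The Cayley transform *)

Section Cayley.
Variables (R : realType) (n : nat) (W : 'M[R]_n).
Hypothesis skewW : W^T = - W.

Definition affine_mx (M : 'M[R]_n) (t : R^o) : 'M[R]_n := 1%:M + t *: M.

Lemma affine_mx_smooth M k : CkMx [set: R^o] k (affine_mx M).
Proof.
apply: CkMxD; [exact: openT|exact: CkMx_cst|].
apply: (CkMx_scale openT); last exact: CkMx_cst.
have idc : continuous (@idfun R^o) by move=> ?.
exact: (Ck_linear _ _ idc).
Qed.

Lemma diff_affine_mx M : diff_mx (affine_mx M) 0 1 = M.
Proof.
apply/matrixP => i j; rewrite mxE.
have := @is_diff_scalel R R^o (0 : R^o) (M i j : R^o).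
have E : (fun t => affine_mx M t i j) = cst (1%:M i j) + ( *:%R^~ (M i j : R^o)).
  by apply/funext => t; rewrite !mxE.
move=> h; have h' := is_diffD (is_diff_cst (1%:M i j : R^o) (0 : R^o)) h.
rewrite E (congr1 (fun h : R^o -> R^o => h 1) (@diff_val _ _ _ _ _ _ _ h')).
by rewrite [LHS]add0r [LHS]mul1r.
Qed.

(** A skew-symmetric matrix has no nonzero real eigenvalue: u W u^T = 0. *)
Lemma skew_affine_unitmx t : affine_mx (- W) t \in unitmx.
Proof.
apply: row_inj_unitmx => u; rewrite /affine_mx scalerN mulmxBr mulmx1 => /subr0_eq e.
apply: dotmx_eq0; rewrite {1}e -scalemxAr -scalemxAl.
have q0 : u *m W *m u^T = - (u *m W *m u^T).
  have eT : (u *m W *m u^T)^T = - (u *m W *m u^T).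
    by rewrite !trmx_mul trmxK skewW mulmxA mulmxN mulNmx.
  by rewrite -[RHS]eT; apply/matrixP => i j; rewrite [RHS]mxE !ord1.
suff -> : u *m W *m u^T = 0 by rewrite scaler0.
by apply/matrixP => i j; have /matrixP /(_ i j) := q0; rewrite !mxE; lra.
Qed.

(** The Cayley transform (1 - t W)^-1 (1 + t W), a rational curve of orthogonal
    matrices through the identity. *)
Definition cayley (t : R^o) : 'M[R]_n := invmx (affine_mx (- W) t) *m affine_mx W t.

Lemma cayley_orthogonal t : orthogonal_group (cayley t).
Proof.
rewrite /orthogonal_group /cayley /=; set P := affine_mx (- W) t.
have uP : P \in unitmx by exact: skew_affine_unitmx.
have PT : P^T = affine_mx W t.
  by rewrite /P /affine_mx linearD linearZ /= trmx1 linearN /= skewW opprK.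
have comm : P *m P^T = P^T *m P.
  rewrite PT /P /affine_mx scalerN; move: (t *: W) => M.
  rewrite !(mulmxDl, mulmxDr, mulmx1, mul1mx, mulmxN, mulNmx).
  by move: (M *m M) => M2; apply/matrixP => i j; rewrite !mxE; ring.
have uPT : P^T \in unitmx by rewrite unitmx_tr.
rewrite -PT trmx_mul trmxK trmx_inv.
have -> : P *m invmx P^T = invmx P^T *m P.
  by rewrite -[LHS](mulKmx uPT) (mulmxA P^T) -comm mulmxK.
by rewrite mulmxA mulmxK // mulVmx.
Qed.

Lemma cayley0 : cayley 0 = 1%:M.
Proof. by rewrite /cayley /affine_mx !scale0r addr0 invmx1 mulmx1. Qed.

Lemma cayley_smooth k : CkMx [set: R^o] k cayley.
Proof.
apply: (CkMxM openT); last exact: affine_mx_smooth.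
apply: (CkMx_inv openT); last exact: affine_mx_smooth.
by move=> t _; exact: skew_affine_unitmx.
Qed.

(** Differentiating (1 - t W) cayley t = 1 + t W at t = 0. *)
Lemma diff_cayley : diff_mx cayley 0 1 = W + W.
Proof.
have dU := CkMx_diffble (I : [set: R^o] 0) (cayley_smooth 1).
have dP := CkMx_diffble (I : [set: R^o] 0) (affine_mx_smooth (- W) 1).
have E : (fun t => affine_mx (- W) t *m cayley t) = affine_mx W.
  by apply/funext => t; rewrite /cayley mulKVmx // skew_affine_unitmx.
have := diff_mxM (1 : R^o) dP dU; rewrite E !diff_affine_mx cayley0 mulmx1.
rewrite /affine_mx scale0r addr0 mul1mx => h.
by apply: (addrI (- W)); rewrite -h addKr.
Qed.

End Cayley.

(** * The vertical space is the kernel of the differential *)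

Section Vertical.
Variables (R : realType) (n m p d : nat).
Local Notation V := (triple R n m p).
Local Notation f := (@On_orbit R n m p).
Local Notation spaceN := (@spaceN R n m p).
Variable A : set (chart R (set V) d).
Hypotheses (manifoldN : smooth_manifold (@orbit_space R n m p) A)
  (submersionN : smooth_submersion spaceN (@orbit_space R n m p) A f).

Let diff_id (x k : V) : 'd id x k = k.
Proof.
have idc : continuous (@idfun V) by move=> y.
exact: (congr1 (fun h : V -> V => h k) (diff_lin x idc)).
Qed.

Lemma component_smooth k : [/\ CkMx [set: V] k (@symA R n m p),
  CkMx [set: V] k (@mxB R n m p) & CkMx [set: V] k (@mxC R n m p)].
Proof.
by split; apply: (Ck_entry openT); apply: Ck_linear; exact: triple_linear_continuous.
Qed.

Lemma diff_component a b (L : {linear V -> 'M[R]_(a, b)}) x k : diff_mx L x k = L k.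
Proof.
have Lc : continuous L by exact: triple_linear_continuous.
have idd : differentiable (id : V -> V) x by [].
by rewrite (diff_mx_linear k Lc idd) diff_id.
Qed.

(** Two functions that agree on an orbit have the same differential along the
    kernel of the differential of the projection. *)
Lemma fibre_diff_mx a b (M M' : V -> 'M[R]_(a, b)) x k : spaceN x ->
  CkMx [set: V] 1 M -> CkMx [set: V] 1 M' ->
  (forall U, orthogonal_group U -> M (On_action U x) = M' (On_action U x)) ->
  mdiff A f x k = 0 -> diff_mx M x k = diff_mx M' x k.
Proof.
move=> Nx sM sM' MM' dk; apply/matrixP => i j; rewrite [LHS]mxE [RHS]mxE; apply/eqP.
have dM := CkMx_diffble (I : [set: V] x) sM i j.
have dM' := CkMx_diffble (I : [set: V] x) sM' i j.
have D := congr1 (fun h : V -> R^o => h k) (diffB dM dM').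
rewrite -subr_eq0; apply/eqP; apply: (etrans (esym D)).
apply: (diff_fibre_mdiff_ker manifoldN submersionN (@triple_coordK R n m p)
  (@triple_coord_continuous R n m p) Nx (differentiableB dM dM') _ dk).
have fib0 U : orthogonal_group U -> M (On_action U x) i j - M' (On_action U x) i j = 0.
  by move=> oU; rewrite MM' // subrr.
have o1 : orthogonal_group (1%:M : 'M[R]_n) by rewrite /orthogonal_group /= trmx1 mul1mx.
move=> y _ /esym/On_orbit_eq [U oU ->]; apply: (etrans (fib0 U oU)).
by have := fib0 _ o1; rewrite On_action1 => /esym.
Qed.

Lemma state_smooth k (u : nat -> 'cV[R]_m) (x0 : 'cV[R]_n) K :
  CkMx [set: V] k (fun y => state (symA y) (mxB y) u x0 K).
Proof.
have [sA sB _] := component_smooth k.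
elim: K => [|K IH] /=; first exact: CkMx_cst.
apply: (CkMxD openT); apply: (CkMxM openT) => //; exact: CkMx_cst.
Qed.

(** By controllability each basis vector e_i is reached from the state 0 by some
    input sequence.  The states reached by the same inputs for other matrices
    (A, B) are the columns of Psi; for the system U o Theta they are U^T e_i. *)
Lemma orbit_section x : spaceN x -> exists Psi : V -> 'M[R]_n,
  [/\ forall k, CkMx [set: V] k Psi, Psi x = 1%:M &
      forall U, orthogonal_group U -> Psi (On_action U x) = U^T].
Proof.
move=> [_ cx _].
have /choice [w wE] : forall i : 'I_n, exists uK : (nat -> 'cV[R]_m) * nat,
    state (symA x) (mxB x) uK.1 0 uK.2 = delta_mx i 0.
  by move=> i; have [u [K e]] := cx 0 (delta_mx i 0); exists (u, K).
pose Psi (y : V) : 'M[R]_n :=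
  \matrix_(a, i) state (symA y) (mxB y) (w i).1 0 (w i).2 a 0.
exists Psi; split=> [k a i||U oU].
- under eq_fun do rewrite mxE; exact: state_smooth.
- by apply/matrixP => a i; rewrite !mxE wE mxE eqxx andbT.
apply/matrixP => a i; rewrite mxE symA_action [mxB _]/(U^T *m mxB x).
rewrite state_action // mulmx0 wE -colE mxE.
by [].
Qed.

(** W is the differential of Psi along k.  On the orbit of x, Psi Psi^T = 1 and the
    components are Psi A Psi^T, Psi B and C Psi^T for (A, B, C) the components of x;
    differentiating these identities at x, where Psi = 1, gives the conclusions. *)
Lemma mdiff_ker_skew x k : spaceN x -> mdiff A f x k = 0 ->
  exists W : 'M[R]_n, [/\ W^T = - W, symA k = W *m symA x - symA x *m W,
    mxB k = W *m mxB x & mxC k = - (mxC x *m W)].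
Proof.
move=> Nx dk; have [Psi [sPsi Psi1 PsiU]] := orbit_section Nx.
have [sA sB sC] := component_smooth 1.
have sPsiT : CkMx [set: V] 1 (fun y => (Psi y)^T) := CkMx_tr (sPsi 1).
have dPsi := CkMx_diffble (I : [set: V] x) (sPsi 1).
have dPsiT := CkMx_diffble (I : [set: V] x) sPsiT.
have sc a b (M : 'M[R]_(a, b)) : CkMx [set: V] 1 (fun=> M) := CkMx_cst _ _ _.
have dc a b (M : 'M[R]_(a, b)) := CkMx_diffble (I : [set: V] x) (sc _ _ M).
pose W := diff_mx Psi x k; exists W.
have skewW : W^T = - W.
  have := fibre_diff_mx Nx (CkMxM openT (sPsi 1%N) sPsiT) (sc _ _ 1%:M) _ dk.
  rewrite (diff_mxM k dPsi dPsiT) diff_mx_tr Psi1 trmx1 mulmx1 mul1mx diff_mx_cst.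
  move=> /(_ _)/eqP; rewrite addrC addr_eq0 => h; apply/eqP/h => U oU.
  by rewrite PsiU // trmxK oU.
split=> //.
- have sPA := CkMxM openT (sPsi 1%N) (sc _ _ (symA x)).
  have dPA := CkMx_diffble (I : [set: V] x) sPA.
  have e := fibre_diff_mx Nx sA (CkMxM openT sPA sPsiT) _ dk.
  rewrite -(diff_component (@symA R n m p) x k) e => [|U oU].
    rewrite (diff_mxM k dPA dPsiT) (diff_mxM k dPsi (dc _ _ _)).
    by rewrite diff_mx_tr diff_mx_cst Psi1 trmx1 mulmx1 mulmx0 addr0 mul1mx skewW mulmxN.
  by rewrite symA_action (PsiU U oU) trmxK.
- have e := fibre_diff_mx Nx sB (CkMxM openT (sPsi 1%N) (sc _ _ (mxB x))) _ dk.
  rewrite -(diff_component (@mxB R n m p) x k) e => [|U oU].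
    by rewrite (diff_mxM k dPsi (dc _ _ _)) diff_mx_cst mulmx0 addr0.
  by rewrite PsiU.
- have e := fibre_diff_mx Nx sC (CkMxM openT (sc _ _ (mxC x)) sPsiT) _ dk.
  rewrite -(diff_component (@mxC R n m p) x k) e => [|U oU].
    rewrite (diff_mxM k (dc _ _ _) dPsiT) diff_mx_cst mul0mx add0r.
    by rewrite diff_mx_tr skewW mulmxN.
  by rewrite (PsiU U oU) trmxK.
Qed.

(** The curve is U(t) o x for U the Cayley transform of - W / 2, since the velocity
    of the Cayley transform of H at 0 is H + H. *)
Lemma skew_vertical x (W : 'M[R]_n) k : spaceN x -> W^T = - W ->
  symA k = W *m symA x - symA x *m W -> mxB k = W *m mxB x ->
  mxC k = - (mxC x *m W) -> vertical spaceN f x k.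
Proof.
move=> Nx skewW kA kB kC.
pose H : 'M[R]_n := - 2^-1 *: W.
have skewH : H^T = - H by rewrite linearZ /= skewW scalerN.
have HH : H + H = - W by apply/matrixP => i j; rewrite !mxE; field.
pose U := cayley H.
pose gamma (t : R^o) : V := On_action (U t) x.
have sU l := cayley_smooth skewH l.
have sUT l : CkMx [set: R^o] l (fun t => (U t)^T) := CkMx_tr (sU l).
have sc l a b (M : 'M[R]_(a, b)) : CkMx [set: R^o] l (fun=> M) := CkMx_cst _ _ _.
have sUA l := CkMxM openT (sUT l) (sc l _ _ (symA x)).
have sgA l : CkMx [set: R^o] l (fun t => symA (gamma t)) := CkMxM openT (sUA l) (sU l).
have sgB l : CkMx [set: R^o] l (fun t => mxB (gamma t)) :=
  CkMxM openT (sUT l) (sc l _ _ (mxB x)).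
have sgC l : CkMx [set: R^o] l (fun t => mxC (gamma t)) :=
  CkMxM openT (sc l _ _ (mxC x)) (sU l).
have sg : smooth_on [set: R^o] gamma by move=> l; apply: (triple_Ck openT).
exists gamma, 1; split=> //.
- by move=> l; apply: sub_Ck (sg l).
- move=> t _; have oU := cayley_orthogonal skewH t.
  by split; [exact: spaceN_action|exact: On_orbit_action].
- by rewrite /gamma /U cayley0 On_action1.
have dg : differentiable gamma 0 by apply: (sg 1).1.
rewrite derive1E' //.
have dd a b (M : R^o -> 'M[R]_(a, b)) : CkMx [set: R^o] 1 M -> diffble_mx M 0.
  exact: CkMx_diffble.
have dU : diff_mx U 0 1 = - W by rewrite diff_cayley.
have dUT : diff_mx (fun t => (U t)^T) 0 1 = W.
  by rewrite diff_mx_tr dU linearN /= skewW opprK.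
have U0 : U 0 = 1%:M by exact: cayley0.
have comp a b (L : {linear V -> 'M[R]_(a, b)}) :
    L ('d gamma 0 1) = diff_mx (fun t => L (gamma t)) 0 1.
  by rewrite diff_mx_linear //; exact: triple_linear_continuous.
apply: triple_eq.
- rewrite (comp _ _ (@symA R n m p)).
  rewrite (diff_mxM (1 : R^o) (dd _ _ _ (sUA 1%N)) (dd _ _ _ (sU 1%N))).
  rewrite (diff_mxM (1 : R^o) (dd _ _ _ (sUT 1%N)) (dd _ _ _ (sc 1%N _ _ _))).
  rewrite diff_mx_cst dU dUT U0 trmx1 mulmx0 addr0 mul1mx.
  by rewrite /U cayley0 mulmx1 mulmxN kA.
- rewrite (comp _ _ (@mxB R n m p)).
  rewrite (diff_mxM (1 : R^o) (dd _ _ _ (sUT 1%N)) (dd _ _ _ (sc 1%N _ _ _))).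
  by rewrite diff_mx_cst dUT mulmx0 addr0 kB.
- rewrite (comp _ _ (@mxC R n m p)).
  rewrite (diff_mxM (1 : R^o) (dd _ _ _ (sc 1%N _ _ _)) (dd _ _ _ (sU 1%N))).
  by rewrite diff_mx_cst dU mul0mx add0r mulmxN kC.
Qed.

Lemma verticalE x : spaceN x -> vertical spaceN f x = [set v | mdiff A f x v = 0].
Proof.
move=> Nx; apply/seteqP; split=> k /= kx.
  exact: (velocities_fibre_ker manifoldN submersionN kx Nx).
by have [W [skewW kA kB kC]] := mdiff_ker_skew Nx kx; exact: skew_vertical kA kB kC.
Qed.

End Vertical.

(** * The quotient metric on the orbit space *)

Theorem mainTheorem2 (R : realType) (n m p d : nat)
    (A : set (chart R (set (triple R n m p)) d)) :
  (0 < n)%N -> (0 < m)%N -> (0 < p)%N ->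
  smooth_manifold (@orbit_space R n m p) A ->
  smooth_submersion (@spaceN R n m p) (@orbit_space R n m p) A
    (@On_orbit R n m p) ->
  [/\ (forall Theta1 Theta2 : triple R n m p,
         spaceN Theta1 -> spaceN Theta2 -> On_orbit Theta1 = On_orbit Theta2 ->
         forall xi zeta,
           tangent_space A (On_orbit Theta1) xi ->
           tangent_space A (On_orbit Theta1) zeta ->
           metricN Theta1 (liftN A Theta1 xi) (liftN A Theta1 zeta) =
           metricN Theta2 (liftN A Theta2 xi) (liftN A Theta2 zeta)),
      riemannian_metric (@orbit_space R n m p) A (quotient_metric A) &
      riemannian_submersion (@spaceN R n m p) (@orbit_space R n m p) A
        (@On_orbit R n m p) (@metricN R n m p) (quotient_metric A)].
Proof.
move=> _ _ _ manifoldN submersionN.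
have coK := @triple_coordK R n m p.
have co_cont := @triple_coord_continuous R n m p.
have lin := @metricN_linear R n m p.
have sym x (_ : spaceN x) := @metricN_sym R n m p x.
have pos (x : triple R n m p) : spaceN x -> forall v, v <> 0 -> 0 < metricN x v v.
  by move=> [posx _ _] v; exact: metricN_pos.
have cometricE (x : triple R n m p) : spaceN x -> forall r v,
    metricN x (triple_frame (r *m cometric x)) v = (r *m (triple_coord v)^T) 0 0.
  by move=> [posx _ _] r v; rewrite frame_cometric metricN_sharp // frame_dot.
have vert := @verticalE R n m p d A manifoldN submersionN.
have iso := @orbit_isometry R n m p.
have wd := lift_metric_invariant coK manifoldN submersionN lin pos
  cometricE vert iso.
have gE (x : triple R n m p) : spaceN x -> forall xi zeta,
    tangent_space A (On_orbit x) xi -> tangent_space A (On_orbit x) zeta ->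
    quotient_metric A (On_orbit x) xi zeta =
    metricN x (liftN A x xi) (liftN A x zeta).
  move=> Nx xi zeta xiT zetaT; rewrite /quotient_metric.
  set S := @spaceN R n m p `&` _.
  have [Ny fy] : S (xget 0 S) by apply: (@xgetPex _ 0 S); exists x.
  by apply: wd => //; rewrite fy.
have fX : @orbit_space R n m p `<=` @On_orbit R n m p @` @spaceN R n m p by [].
split.
- move=> x y Nx Ny fxy xi zeta xiT zetaT; exact: wd.
- exact: (quotient_riemannian_metric coK co_cont manifoldN submersionN fX lin sym pos
    (@cometric_smooth R n m p) cometricE vert gE).
- exact: (quotient_riemannian_submersion coK manifoldN submersionN lin pos
    cometricE vert gE).
Qed.
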